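(* Suppose either (1) $X$ is a metric graph and $0<r\le\ell(X)/4$, or (2) $X$ is a geodesic space with $r(X)>0$ and $0<r\le r(X)/2$. Then the inclusions $\operatorname{Cech}(X,r/2)\hookrightarrow\operatorname{Rips}(X,r)\hookrightarrow\operatorname{Cech}(X,r)$ are homotopy equivalences.
   Context: For a metric space $X$ and $r>0$: $\operatorname{Cech}(X,r)$ is the simplicial complex with vertex set $X$ in which a finite $\sigma\subset X$ is a simplex iff $\bigcap_{a\in\sigma}B(a,r)\neq\emptyset$ ($B$ the open ball); $\operatorname{Rips}(X,r)$ has vertex set $X$ and simplices the finite subsets of diameter $<r$; weak topology. A metric graph is a finite graph with a geodesic metric; $\ell(X)$ is the length of its shortest non-contractible loop. A metric space is geodesic if any two points $x,y$ are joined by a path of length $d(x,y)$. For a geodesic space $X$, $r(X)\ge0$ is the supremum of the real numbers $r$ satisfying: (1) for all $x,y$ with $d(x,y)<2r$ there is a unique shortest geodesic from $x$ to $y$; (2) if $d(x,y),d(u,x),d(u,y)<r$ and $z$ lies on the geodesic joining $x,y$, then $d(u,z)\le\max\{d(u,x),d(u,y)\}$; (3) if $\gamma,\gamma'$ are arc-length parameterized geodesics with $\gamma(0)=\gamma'(0)$, $0\le s,s'<r$, $0\le t<1$, then $d(\gamma(ts),\gamma'(ts'))\le d(\gamma(s),\gamma'(s'))$. *)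

(* Defs.v *)
From Stdlib Require Import Reals Lra List.
From Coquelicot Require Import Coquelicot.
Import ListNotations.
Open Scope R_scope.

Section Defs.
Variable X : Type.
Variable d : X -> X -> R.

Definition is_metric : Prop :=
  (forall x y, 0 <= d x y) /\ (forall x y, d x y = 0 <-> x = y) /\
  (forall x y, d x y = d y x) /\ (forall x y z, d x z <= d x y + d y z).

Definition cont_on (g : R -> X) (a b : R) : Prop :=
  forall t, a <= t <= b -> forall eps, 0 < eps -> exists delta, 0 < delta /\
    forall s, a <= s <= b -> Rabs (s - t) < delta -> d (g s) (g t) < eps.

Fixpoint chain_sum (g : R -> X) (a : R) (l : list R) : R :=
  match l with nil => 0 | t :: l' => d (g a) (g t) + chain_sum g t l' end.

Fixpoint incr_from (a : R) (l : list R) : Prop :=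
  match l with nil => True | t :: l' => a <= t /\ incr_from t l' end.

(* a = t0 <= t1 <= ... <= tn = b is given by the list [t1;...;tn] *)
Definition partition (a b : R) (l : list R) : Prop :=
  incr_from a l /\ last l a = b.

Definition path_length (g : R -> X) (a b : R) : Rbar :=
  Lub_Rbar (fun v => exists l, partition a b l /\ v = chain_sum g a l).

Definition geod_on (g : R -> X) (a b : R) : Prop :=
  forall s t, a <= s <= b -> a <= t <= b -> d (g s) (g t) = Rabs (s - t).

Definition geod_from_to (g : R -> X) (x y : X) : Prop :=
  geod_on g 0 (d x y) /\ g 0 = x /\ g (d x y) = y.

Definition geodesic_space : Prop :=
  forall x y, exists g, geod_from_to g x y.

Definition rX_cond (rho : R) : Prop :=
  (forall x y, d x y < 2 * rho ->
     exists g, geod_from_to g x y /\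
       forall g', geod_from_to g' x y -> forall t, 0 <= t <= d x y -> g' t = g t) /\
  (forall x y u g t, d x y < rho -> d u x < rho -> d u y < rho ->
     geod_from_to g x y -> 0 <= t <= d x y ->
     d u (g t) <= Rmax (d u x) (d u y)) /\
  (forall (g g' : R -> X) s s' t, 0 <= s < rho -> 0 <= s' < rho -> 0 <= t < 1 ->
     geod_on g 0 s -> geod_on g' 0 s' -> g 0 = g' 0 ->
     d (g (t * s)) (g' (t * s')) <= d (g s) (g' s')).

Definition rX : Rbar := Lub_Rbar rX_cond.

(* X (with metric d) is a finite graph with a geodesic metric: a geodesic
   space which is the union of finitely many vertices V and edges
   phi i : [0, L i] -> X (i < n), each edge of length L i > 0 parameterized
   by arc length, with endpoints in V, injective on the open edge, open edges
   pairwise disjoint and disjoint from V (loops / multiple edges allowed). *)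
Definition is_metric_graph : Prop :=
  geodesic_space /\
  exists (V : list X) (n : nat) (L : nat -> R) (phi : nat -> R -> X),
    (forall i, (i < n)%nat ->
       0 < L i /\ cont_on (phi i) 0 (L i) /\
       In (phi i 0) V /\ In (phi i (L i)) V /\
       (forall a b, 0 <= a <= b -> b <= L i -> path_length (phi i) a b = Finite (b - a)) /\
       (forall s t, 0 < s < L i -> 0 < t < L i -> phi i s = phi i t -> s = t) /\
       (forall s, 0 < s < L i -> ~ In (phi i s) V)) /\
    (forall i j s t, (i < n)%nat -> (j < n)%nat -> i <> j ->
       0 < s < L i -> 0 < t < L j -> phi i s <> phi j t) /\
    (forall x, In x V \/ exists i s, (i < n)%nat /\ 0 <= s <= L i /\ phi i s = x).

Definition loop (g : R -> X) : Prop := cont_on g 0 1 /\ g 0 = g 1.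

Definition cont_sq (H : R -> R -> X) : Prop :=
  forall u s, 0 <= u <= 1 -> 0 <= s <= 1 -> forall eps, 0 < eps ->
    exists delta, 0 < delta /\ forall v w, 0 <= v <= 1 -> 0 <= w <= 1 ->
      Rabs (v - u) < delta -> Rabs (w - s) < delta -> d (H v w) (H u s) < eps.

Definition contractible_loop (g : R -> X) : Prop :=
  exists H : R -> R -> X, cont_sq H /\
    (forall s, 0 <= s <= 1 -> H 0 s = g s) /\
    (exists c, forall s, 0 <= s <= 1 -> H 1 s = c) /\
    (forall u, 0 <= u <= 1 -> H u 0 = H u 1).

(* l(X): length of the shortest non-contractible loop (+oo if none) *)
Definition ell : Rbar :=
  Glb_Rbar (fun v => exists g, loop g /\ ~ contractible_loop g /\
                               path_length g 0 1 = Finite v).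

(* a complex is a predicate on finite nonempty vertex lists (simplices) *)
Definition complex := list X -> Prop.

Definition Cech (r : R) : complex :=
  fun s => s <> nil /\ exists z : X, forall a, In a s -> d a z < r.

Definition Rips (r : R) : complex :=
  fun s => s <> nil /\ forall a b, In a s -> In b s -> d a b < r.

(* points of the closed geometric simplex spanned by s: barycentric
   coordinate functions X -> R *)
Definition in_cell (s : list X) (t : X -> R) : Prop :=
  NoDup s /\ (forall x, 0 <= t x) /\ (forall x, ~ In x s -> t x = 0) /\
  fold_right (fun x acc => t x + acc) 0 s = 1.

Definition in_real (K : complex) (t : X -> R) : Prop :=
  exists s, K s /\ in_cell s t.

(* open sets of |K| in the weak topology: U meets every closed simplex in a
   relatively (Euclidean) open set *)
Definition wopen (K : complex) (U : (X -> R) -> Prop) : Prop :=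
  forall s t, K s -> in_cell s t -> U t ->
    exists eps, 0 < eps /\ forall t', in_cell s t' ->
      (forall x, Rabs (t' x - t x) < eps) -> U t'.

Definition maps_real (K L : complex) (f : (X -> R) -> (X -> R)) : Prop :=
  forall t, in_real K t -> in_real L (f t).

Definition wcont (K L : complex) (f : (X -> R) -> (X -> R)) : Prop :=
  forall U, wopen L U -> wopen K (fun t => U (f t)).

(* continuity of H : [0,1] x |K| -> |L|; the topology of [0,1] x |K| is the
   weak topology w.r.t. the sets [0,1] x (closed simplex), which coincides
   with the product topology since [0,1] is locally compact *)
Definition hcont (K L : complex) (H : R -> (X -> R) -> (X -> R)) : Prop :=
  forall U, wopen L U -> forall s u t, K s -> in_cell s t -> 0 <= u <= 1 ->
    U (H u t) ->
    exists eps, 0 < eps /\ forall u' t', in_cell s t' -> 0 <= u' <= 1 ->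
      Rabs (u' - u) < eps -> (forall x, Rabs (t' x - t x) < eps) -> U (H u' t').

Definition homotopic (K L : complex) (f g : (X -> R) -> (X -> R)) : Prop :=
  exists H, hcont K L H /\
    (forall u t, 0 <= u <= 1 -> in_real K t -> in_real L (H u t)) /\
    (forall t, in_real K t -> H 0 t = f t /\ H 1 t = g t).

Definition homotopy_equivalence (K L : complex) (f : (X -> R) -> (X -> R)) : Prop :=
  maps_real K L f /\ wcont K L f /\
  exists g, maps_real L K g /\ wcont L K g /\
    homotopic K K (fun t => g (f t)) (fun t => t) /\
    homotopic L L (fun t => f (g t)) (fun t => t).

Definition incl_he (K L : complex) : Prop :=
  (forall s, K s -> L s) /\ homotopy_equivalence K L (fun t => t).

End Defs.

(* Main.v *)
Require Import Defs.
From Stdlib Require Import Reals Lra Lia Arith List Permutation.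
From Stdlib Require Import Classical ClassicalEpsilon FunctionalExtensionality PropExtensionality.
From Coquelicot Require Import Coquelicot.
Import ListNotations.
Open Scope R_scope.

(* Both cases provide a "combing": along geodesics every point x of an open r-ball contracts to
   any point p of the same ball, without leaving the ball and without increasing distances
   between points. Hence the r-hull Y of a set contained in an r-ball (the intersection of all
   r-balls containing it) is contractible in such a way that the parts of the Rips and Cech
   complexes lying in Y are contractible too. Assigning to a simplex s the part of a complex
   lying in the hull of s (or, so as to contain the centres of s, in the hull of its
   r/2-neighbourhood) gives contractible carriers, monotone in s; extending cell by cell along
   them produces homotopy inverses of the inclusions and the required homotopies.

   In case (2) the combing is given by the definition of r(X). In a metric graph with
   4r <= l(X), every geodesic triangle of perimeter < 4r has each side contained in the union
   of the other two: otherwise the triangle would be a loop of length < l(X) crossing some arc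
   of an edge exactly once, and the winding number of its image in the circle obtained by
   collapsing the complement of that arc would be 1 or -1. Thus r-balls are 0-hyperbolic, and
   the four-point condition yields the nonexpanding contraction. *)

(** * Finite sums *)

(** The weak topology is the main obstacle: a realization need not be locally finite. Hence every
    map is controlled cell by cell, each cell being sent into a finite subcomplex, where weak and
    sup-metric continuity coincide; and contractions are built only for finite subcomplexes, with a
    subdivision of time fine enough for finitely many simplices. The strict inequalities defining
    the complexes provide the slack that the subdivision consumes. The constants come from an
    r-ball: two of its points are less than 2r apart, whence r <= r(X)/2, and a triangle formed by
    two of them and the centre has perimeter below 4r, whence 4r <= l(X). Hulls replace balls
    because an r-ball containing a simplex cannot be chosen monotonically. The r/2-neighbourhood
    occurs because a Cech simplex of radius r/2 has a centre that must move along with it; this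
    neighbourhood still lies in the r-ball about any such centre. *)

Definition lsum {A : Type} (l : list A) (f : A -> R) : R :=
  fold_right (fun x acc => f x + acc) 0 l.

Lemma lsum_app {A} (l l' : list A) f : lsum (l ++ l') f = lsum l f + lsum l' f.
Proof. induction l as [|a l IH]; simpl; [ring|]. rewrite IH; ring. Qed.

Lemma lsum_ext {A} (l : list A) f g :
  (forall a, In a l -> f a = g a) -> lsum l f = lsum l g.
Proof.
  induction l as [|a l IH]; simpl; intros H; [reflexivity|].
  rewrite (H a), IH; auto.
Qed.

Lemma lsum_0 {A} (l : list A) f : (forall a, In a l -> f a = 0) -> lsum l f = 0.
Proof.
  induction l as [|a l IH]; simpl; intros H; [reflexivity|].
  rewrite (H a), IH; auto; ring.
Qed.

Lemma lsum_plus {A} (l : list A) f g : lsum l (fun a => f a + g a) = lsum l f + lsum l g.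
Proof. induction l as [|a l IH]; simpl; [ring|]. rewrite IH; ring. Qed.

Lemma lsum_scal {A} (l : list A) c f : lsum l (fun a => c * f a) = c * lsum l f.
Proof. induction l as [|a l IH]; simpl; [ring|]. rewrite IH; ring. Qed.

Lemma lsum_const {A} (l : list A) c : lsum l (fun _ => c) = INR (length l) * c.
Proof.
  induction l as [|a l IH]; [simpl; ring|].
  change (lsum (a :: l) (fun _ => c)) with (c + lsum l (fun _ => c)).
  change (length (a :: l)) with (S (length l)). rewrite IH, S_INR; ring.
Qed.

Lemma lsum_le {A} (l : list A) f g :
  (forall a, In a l -> f a <= g a) -> lsum l f <= lsum l g.
Proof.
  induction l as [|a l IH]; simpl; intros H; [lra|].
  apply Rplus_le_compat; auto.
Qed.

Lemma lsum_ge0 {A} (l : list A) f : (forall a, In a l -> 0 <= f a) -> 0 <= lsum l f.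
Proof.
  intros H. apply Rle_trans with (lsum l (fun _ => 0)).
  - rewrite lsum_0; auto; lra.
  - apply lsum_le; auto.
Qed.

Lemma lsum_ge_term {A} (l : list A) f a :
  (forall b, In b l -> 0 <= f b) -> In a l -> f a <= lsum l f.
Proof.
  induction l as [|b l IH]; simpl; intros H Ha; [easy|].
  assert (0 <= lsum l f) by (apply lsum_ge0; auto).
  destruct Ha as [->|Ha]; [lra|].
  pose proof (H b (or_introl eq_refl)). specialize (IH (fun b Hb => H b (or_intror Hb)) Ha). lra.
Qed.

Lemma lsum_exchange {A B} (l : list A) (l' : list B) (f : A -> B -> R) :
  lsum l (fun a => lsum l' (f a)) = lsum l' (fun b => lsum l (fun a => f a b)).
Proof.
  induction l as [|a l IH]; simpl.
  - symmetry; apply lsum_0; auto.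
  - rewrite IH, <- lsum_plus. reflexivity.
Qed.

Lemma lsum_map {A B} (l : list A) (g : A -> B) f : lsum (map g l) f = lsum l (fun a => f (g a)).
Proof. induction l as [|a l IH]; simpl; [reflexivity|]. rewrite IH; reflexivity. Qed.

Lemma lsum_list_prod {A B} (l : list A) (l' : list B) (f : A * B -> R) :
  lsum (list_prod l l') f = lsum l (fun a => lsum l' (fun b => f (a, b))).
Proof.
  induction l as [|a l IH]; simpl; [reflexivity|].
  rewrite lsum_app, lsum_map, IH. reflexivity.
Qed.

Lemma lsum_perm {A} (l l' : list A) f : Permutation l l' -> lsum l f = lsum l' f.
Proof. induction 1; simpl; lra. Qed.

Lemma lsum_filter {A} (l : list A) (b : A -> bool) f :
  (forall a, In a l -> b a = false -> f a = 0) -> lsum (filter b l) f = lsum l f.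
Proof.
  induction l as [|a l IH]; simpl; intros H; [reflexivity|].
  destruct (b a) eqn:E; simpl; rewrite IH; auto.
  rewrite (H a); auto; ring.
Qed.

(** [Q] survives shrinking the tolerance, so the minimum of the individual tolerances serves all of
    [l]. *)
Lemma fin_eps {A} (l : list A) (Q : A -> R -> Prop) :
  (forall a e e', Q a e -> 0 < e' <= e -> Q a e') ->
  (forall a, In a l -> exists e, 0 < e /\ Q a e) ->
  exists e, 0 < e /\ forall a, In a l -> Q a e.
Proof.
  intros Hm. induction l as [|a l IH]; intros H.
  - exists 1; split; [lra|]; easy.
  - destruct IH as [e [He IH]]; [intros; apply H; right; auto|].
    destruct (H a (or_introl eq_refl)) as [e' [He' Ha]].
    assert (0 < Rmin e e') by (apply Rmin_pos; auto).
    exists (Rmin e e'); split; auto.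
    intros b [<-|Hb].
    + apply Hm with e'; auto. split; auto; apply Rmin_r.
    + apply Hm with e; auto. split; auto; apply Rmin_l.
Qed.

Definition dec (P : Prop) : bool := if excluded_middle_informative P then true else false.

Lemma decP P : dec P = true <-> P.
Proof. unfold dec; destruct (excluded_middle_informative P); split; easy. Qed.

Lemma decN P : dec P = false <-> ~ P.
Proof. unfold dec; destruct (excluded_middle_informative P); split; easy. Qed.

Definition ceq_dec {A : Type} (x y : A) : {x = y} + {x <> y} :=
  excluded_middle_informative (x = y).

(** Allows minima over all faces with vertices in a finite list: each vertex set that [filter]
    selects occurs here. *)
Fixpoint sublists {A} (l : list A) : list (list A) :=
  match l with
  | [] => [[]]
  | a :: l' => map (cons a) (sublists l') ++ sublists l'
  end.

Lemma filter_in_sublists {A} (b : A -> bool) l : In (filter b l) (sublists l).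
Proof.
  induction l as [|a l IH]; simpl; auto.
  apply in_or_app. destruct (b a); auto. left. apply in_map; auto.
Qed.

(** * Cells and supports in the geometric realization *)

Section Realization.
Context {X : Type}.
Implicit Types (t y : X -> R) (s M : list X) (C K L : complex X).

(* Depends on P only up to extensionality, so it names a simplex independently of the
   order of its vertices. *)
Definition listing (P : X -> Prop) : list X :=
  epsilon (inhabits []) (fun l => NoDup l /\ forall x, In x l <-> P x).

Lemma listing_spec (P : X -> Prop) l :
  (forall x, P x -> In x l) ->
  NoDup (listing P) /\ forall x, In x (listing P) <-> P x.
Proof.
  intros H. unfold listing.
  apply (epsilon_spec (inhabits []) (fun l => NoDup l /\ forall x, In x l <-> P x)).
  exists (nodup ceq_dec (filter (fun x => dec (P x)) l)). split.
  - apply NoDup_nodup.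
  - intros x. rewrite nodup_In, filter_In, decP. intuition.
Qed.

Lemma listing_ext (P Q : X -> Prop) : (forall x, P x <-> Q x) -> listing P = listing Q.
Proof.
  intros H. f_equal. apply functional_extensionality; intros x.
  apply propositional_extensionality; auto.
Qed.

Definition supp t : list X := listing (fun x => t x <> 0).

Lemma supp_spec s t : in_cell X s t ->
  NoDup (supp t) /\ forall x, In x (supp t) <-> t x <> 0.
Proof.
  intros (_ & _ & H & _). apply listing_spec with s.
  intros x Hx. apply NNPP. intros Hn. apply Hx, H; auto.
Qed.

Lemma lsum_same_supp s s' t : NoDup s -> NoDup s' ->
  (forall x, t x <> 0 -> In x s) -> (forall x, t x <> 0 -> In x s') -> lsum s t = lsum s' t.
Proof.
  intros Hs Hs' H H'.
  assert (E : forall l, lsum l t = lsum (filter (fun x => dec (t x <> 0)) l) t).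
  { intros l. symmetry. apply lsum_filter. intros a _ Ha.
    apply decN in Ha. apply NNPP; auto. }
  rewrite (E s), (E s'). apply lsum_perm, NoDup_Permutation.
  - apply NoDup_filter; auto.
  - apply NoDup_filter; auto.
  - intros x. rewrite !filter_In, decP. intuition.
Qed.

Lemma in_cell_change s s' t : in_cell X s t -> NoDup s' ->
  (forall x, t x <> 0 -> In x s') -> in_cell X s' t.
Proof.
  intros (Hs & Hp & H0 & H1) Hs' H. split; [|split; [|split]]; auto.
  - intros x Hx. apply NNPP. intros Hn; auto.
  - rewrite <- H1. apply lsum_same_supp; auto.
    intros x Hx. apply NNPP. intros Hn. apply Hx, H0; auto.
Qed.

Lemma in_cell_In s t x : in_cell X s t -> t x <> 0 -> In x s.
Proof. intros (_ & _ & H & _) Hx. apply NNPP. intros Hn; auto. Qed.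

Lemma in_cell_supp s t : in_cell X s t ->
  in_cell X (supp t) t /\ incl (supp t) s /\ supp t <> [].
Proof.
  intros H. destruct (supp_spec _ _ H) as [Hn Hi].
  assert (Hc : in_cell X (supp t) t).
  { apply in_cell_change with s; auto. intros x; apply Hi. }
  split; [|split]; auto.
  - intros x Hx. apply Hi in Hx. eapply in_cell_In; eauto.
  - intros E. rewrite E in Hc. destruct Hc as (_ & _ & _ & Hc). simpl in Hc. lra.
Qed.

Definition down_closed C : Prop :=
  forall s s', C s -> s' <> [] -> incl s' s -> C s'.

(** [M] need not span a simplex; it only confines [y] to a finite subcomplex, in the role of
    compactness of images. *)
Definition lands C M y : Prop := exists s, C s /\ incl s M /\ in_cell X s y.

Lemma lands_supp C M y : down_closed C -> lands C M y ->
  C (supp y) /\ incl (supp y) M /\ in_cell X (supp y) y.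
Proof.
  intros HC (s & Hs & Hi & Hc).
  destruct (in_cell_supp _ _ Hc) as (H1 & H2 & H3).
  split; [|split]; auto.
  - apply HC with s; auto.
  - apply incl_tran with s; auto.
Qed.

Lemma lands_mono C C' M M' y : (forall s, C s -> C' s) -> incl M M' ->
  lands C M y -> lands C' M' y.
Proof.
  intros H Hi (s & Hs & Hm & Hc). exists s; split; [|split]; auto.
  apply incl_tran with M; auto.
Qed.

Lemma lands_real C M y : lands C M y -> in_real X C y.
Proof. intros (s & Hs & _ & Hc). exists s; auto. Qed.

Definition close (eps : R) t t' : Prop := forall x, Rabs (t' x - t x) < eps.

Lemma close_mono e e' t t' : e <= e' -> close e t t' -> close e' t t'.
Proof. intros H Hc x. apply Rlt_le_trans with e; auto. Qed.

(** The affine combination of the vertices [v j] with weights [w j]. Repeated vertices have their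
    weights added, so [v] need not be injective. *)
Definition comb {J} (l : list J) (w : J -> R) (v : J -> X) : X -> R :=
  fun x => lsum l (fun j => if ceq_dec (v j) x then w j else 0).

Lemma lsum_indicator s x c : NoDup s -> In x s ->
  lsum s (fun z => if ceq_dec x z then c else 0) = c.
Proof.
  induction s as [|a s IH]; simpl; intros Hn Hx; [easy|].
  apply NoDup_cons_iff in Hn as [Ha Hn].
  destruct (ceq_dec x a) as [->|Hxa].
  - rewrite lsum_0; [ring|]. intros b Hb. destruct (ceq_dec a b) as [->|]; easy.
  - destruct Hx as [->|Hx]; [easy|]. rewrite IH; auto; ring.
Qed.

Lemma in_cell_comb {J} (l : list J) w (v : J -> X) s : NoDup s ->
  (forall j, In j l -> 0 <= w j) -> lsum l w = 1 ->
  (forall j, In j l -> w j <> 0 -> In (v j) s) -> in_cell X s (comb l w v).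
Proof.
  intros Hs Hw H1 Hv. split; [|split; [|split]]; auto.
  - intros x. apply lsum_ge0. intros j Hj. destruct (ceq_dec (v j) x); auto; lra.
  - intros x Hx. apply lsum_0. intros j Hj. destruct (ceq_dec (v j) x) as [<-|]; auto.
    apply NNPP. intros Hn. auto.
  - change (lsum s (comb l w v) = 1). unfold comb. rewrite lsum_exchange, <- H1.
    apply lsum_ext. intros j Hj. destruct (Req_dec (w j) 0) as [E|E].
    + rewrite E. apply lsum_0. intros x _. destruct (ceq_dec (v j) x); auto.
    + apply lsum_indicator; auto.
Qed.

Lemma lands_comb {J} C (l : list J) w (v : J -> X) s M : down_closed C -> C s -> incl s M ->
  (forall j, In j l -> 0 <= w j) -> lsum l w = 1 ->
  (forall j, In j l -> w j <> 0 -> In (v j) s) -> lands C M (comb l w v).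
Proof.
  intros HC Hs Hi Hw H1 Hv.
  exists (nodup ceq_dec s). split; [|split].
  - apply HC with s; auto.
    + intros E. assert (lsum l w = 0); [|lra].
      apply lsum_0. intros j Hj. apply NNPP. intros Hn.
      apply (in_nil (a := v j)). rewrite <- E. apply nodup_In; auto.
    + intros x Hx. apply nodup_In in Hx; auto.
  - intros x Hx. apply nodup_In in Hx; auto.
  - apply in_cell_comb; auto; [apply NoDup_nodup|].
    intros j Hj Hn. apply nodup_In; auto.
Qed.

(** * Continuity in the sup metric *)

(** Neighbourhoods are relative to the domain [D], so that the behaviour of maps outside it is
    irrelevant. *)
Definition near (D : R -> (X -> R) -> Prop) (u : R) t (P : R -> (X -> R) -> Prop) : Prop :=
  exists del, 0 < del /\ forall u' t', D u' t' -> Rabs (u' - u) < del -> close del t t' -> P u' t'.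

Definition contR (D : R -> (X -> R) -> Prop) (m : R -> (X -> R) -> R) : Prop :=
  forall u t, D u t -> forall eps, 0 < eps ->
    near D u t (fun u' t' => Rabs (m u' t' - m u t) < eps).

Definition cont2 (D : R -> (X -> R) -> Prop) (f : R -> (X -> R) -> X -> R) : Prop :=
  forall u t, D u t -> forall eps, 0 < eps ->
    near D u t (fun u' t' => close eps (f u t) (f u' t')).

Definition rclosed (D E : R -> (X -> R) -> Prop) : Prop :=
  forall u t, D u t -> ~ E u t -> near D u t (fun u' t' => ~ E u' t').

Lemma near_fin {A} (l : list A) D u t (P : A -> R -> (X -> R) -> Prop) :
  (forall a, In a l -> near D u t (P a)) ->
  near D u t (fun u' t' => forall a, In a l -> P a u' t').
Proof.
  intros H.
  destruct (fin_eps l (fun a del => forall u' t', D u' t' -> Rabs (u' - u) < del ->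
    close del t t' -> P a u' t')) as [e [He HQ]]; auto.
  - intros a e e' Ha He u' t' HD Hu Ht. apply Ha; auto; [lra|].
    apply close_mono with e'; auto; lra.
  - exists e; split; auto.
Qed.

Lemma near_and D u t P Q : near D u t P -> near D u t Q ->
  near D u t (fun u' t' => P u' t' /\ Q u' t').
Proof.
  intros HP HQ.
  destruct (near_fin [true; false] D u t (fun b => if b then P else Q)) as (e & He & H).
  - intros [|] _; auto.
  - exists e; split; auto. intros u' t' HD Hu Ht. split.
    + apply (H u' t' HD Hu Ht true); simpl; auto.
    + apply (H u' t' HD Hu Ht false); simpl; auto.
Qed.

Lemma near_imp D D' u t P Q : (forall u' t', D' u' t' -> D u' t') ->
  (forall u' t', D' u' t' -> P u' t' -> Q u' t') ->
  near D u t P -> near D' u t Q.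
Proof. intros HD H (e & He & HP). exists e; split; auto. Qed.

Lemma cont2_sub D D' f f' : cont2 D f -> (forall u t, D' u t -> D u t) ->
  (forall u t, D' u t -> f u t = f' u t) -> cont2 D' f'.
Proof.
  intros Hf HD He u t Ht eps Heps. eapply near_imp; [| |exact (Hf u t (HD _ _ Ht) eps Heps)]; auto.
  intros u' t' Ht'. rewrite !He; auto.
Qed.

(** Gluing over finitely many closed pieces: those missing the point are missed by nearby points
    too, and each of the others contributes its own modulus. *)
Lemma cont2_paste {A} (l : list A) D (E : A -> R -> (X -> R) -> Prop) f :
  (forall u t, D u t -> exists a, In a l /\ E a u t) ->
  (forall a, In a l -> rclosed D (E a)) ->
  (forall a, In a l -> cont2 (fun u t => D u t /\ E a u t) f) ->
  cont2 D f.
Proof.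
  intros Hcov Hcl Hf u t Ht eps Heps.
  apply near_imp with (D := D)
    (P := fun u' t' => forall a, In a l -> E a u' t' -> close eps (f u t) (f u' t')); auto.
  - intros u' t' Ht' H. destruct (Hcov u' t' Ht') as (a & Ha & HE). apply (H a); auto.
  - apply near_fin. intros a Ha. destruct (classic (E a u t)) as [HE|HE].
    + destruct (Hf a Ha u t (conj Ht HE) eps Heps) as (e & He & H).
      exists e; split; auto.
    + eapply near_imp; [| |exact (Hcl a Ha u t Ht HE)]; auto. easy.
Qed.

Lemma cont2_comp D D' (m : R -> (X -> R) -> R) f h :
  contR D m -> cont2 D f -> cont2 D' h -> (forall u t, D u t -> D' (m u t) (f u t)) ->
  cont2 D (fun u t => h (m u t) (f u t)).
Proof.
  intros Hm Hf Hh HD u t Ht eps Heps.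
  destruct (Hh _ _ (HD u t Ht) eps Heps) as (e & He & H).
  eapply near_imp; [| |exact (near_and _ _ _ _ _ (Hm u t Ht e He) (Hf u t Ht e He))]; auto.
  intros u' t' Ht' [H1 H2]. apply H; auto.
Qed.

(** Only finitely many coordinates vary, so sup-metric continuity can be tested on each of them. *)
Lemma cont2_coord D f M :
  (forall u t x, D u t -> ~ In x M -> f u t x = 0) ->
  (forall x, In x M -> contR D (fun u t => f u t x)) -> cont2 D f.
Proof.
  intros H0 H u t Ht eps Heps.
  apply near_imp with (D := D)
    (P := fun u' t' => forall x, In x M -> Rabs (f u' t' x - f u t x) < eps); auto.
  - intros u' t' Ht' HM x. destruct (classic (In x M)) as [Hx|Hx]; auto.
    rewrite !H0; auto. rewrite Rminus_0_r, Rabs_R0; auto.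
  - apply near_fin. intros x Hx. apply (H x Hx u t Ht eps Heps).
Qed.

Lemma contR_comp2 D m1 m2 (phi : R -> R -> R) : contR D m1 -> contR D m2 ->
  (forall u t, D u t -> continuity_2d_pt phi (m1 u t) (m2 u t)) ->
  contR D (fun u t => phi (m1 u t) (m2 u t)).
Proof.
  intros H1 H2 Hphi u t Ht eps Heps.
  destruct (Hphi u t Ht (mkposreal eps Heps)) as [e He].
  eapply near_imp;
    [| |exact (near_and _ _ _ _ _ (H1 u t Ht e (cond_pos e)) (H2 u t Ht e (cond_pos e)))]; auto.
  intros u' t' _ [A B]. apply (He _ _ A B).
Qed.

Lemma contR_const D c : contR D (fun _ _ => c).
Proof.
  intros u t _ eps Heps. exists 1; split; [lra|]. intros. rewrite Rminus_diag, Rabs_R0; auto.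
Qed.

Lemma contR_time D : contR D (fun u _ => u).
Proof. intros u t _ eps Heps. exists eps; auto. Qed.

Lemma contR_coord D x : contR D (fun _ t => t x).
Proof. intros u t _ eps Heps. exists eps; auto. Qed.

Lemma contR_plus D m1 m2 : contR D m1 -> contR D m2 -> contR D (fun u t => m1 u t + m2 u t).
Proof.
  intros H1 H2; apply (contR_comp2 D m1 m2 Rplus); auto. intros.
  apply (continuity_2d_pt_plus (fun a _ => a) (fun _ b => b));
    [apply continuity_2d_pt_id1|apply continuity_2d_pt_id2].
Qed.

Lemma contR_mult D m1 m2 : contR D m1 -> contR D m2 -> contR D (fun u t => m1 u t * m2 u t).
Proof.
  intros H1 H2; apply (contR_comp2 D m1 m2 Rmult); auto. intros.
  apply (continuity_2d_pt_mult (fun a _ => a) (fun _ b => b));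
    [apply continuity_2d_pt_id1|apply continuity_2d_pt_id2].
Qed.

Lemma contR_minus D m1 m2 : contR D m1 -> contR D m2 -> contR D (fun u t => m1 u t - m2 u t).
Proof.
  intros H1 H2; apply (contR_comp2 D m1 m2 Rminus); auto. intros.
  apply (continuity_2d_pt_minus (fun a _ => a) (fun _ b => b));
    [apply continuity_2d_pt_id1|apply continuity_2d_pt_id2].
Qed.

Lemma contR_div D m1 m2 : contR D m1 -> contR D m2 -> (forall u t, D u t -> m2 u t <> 0) ->
  contR D (fun u t => m1 u t / m2 u t).
Proof.
  intros H1 H2 H3; apply (contR_comp2 D m1 m2 Rdiv); auto. intros.
  apply (continuity_2d_pt_mult (fun a _ => a) (fun _ b => / b)); [apply continuity_2d_pt_id1|].
  apply (continuity_2d_pt_inv (fun _ b => b)); [apply continuity_2d_pt_id2|auto].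
Qed.

Lemma contR_min D m1 m2 : contR D m1 -> contR D m2 ->
  contR D (fun u t => Rmin (m1 u t) (m2 u t)).
Proof.
  intros H1 H2; apply (contR_comp2 D m1 m2 Rmin); auto. intros u t _ eps.
  exists eps. intros a b. unfold Rmin, Rabs.
  repeat destruct Rle_dec; repeat destruct Rcase_abs; lra.
Qed.

Lemma contR_max D m1 m2 : contR D m1 -> contR D m2 ->
  contR D (fun u t => Rmax (m1 u t) (m2 u t)).
Proof.
  intros H1 H2; apply (contR_comp2 D m1 m2 Rmax); auto. intros u t _ eps.
  exists eps. intros a b. unfold Rmax, Rabs.
  repeat destruct Rle_dec; repeat destruct Rcase_abs; lra.
Qed.

Lemma contR_lsum {J} D (l : list J) (w : J -> R -> (X -> R) -> R) :
  (forall j, In j l -> contR D (w j)) -> contR D (fun u t => lsum l (fun j => w j u t)).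
Proof.
  induction l as [|j l IH]; intros H; simpl.
  - apply contR_const.
  - apply contR_plus; [apply H; simpl; auto|]. apply IH. intros; apply H; simpl; auto.
Qed.

Lemma rclosed_le D m c : contR D m -> rclosed D (fun u t => m u t <= c).
Proof.
  intros H u t Ht Hn. eapply near_imp; [| |exact (H u t Ht (m u t - c) ltac:(lra))]; auto.
  intros u' t' _ Ha. apply Rabs_def2 in Ha. lra.
Qed.

Lemma cont2_comb {J} D (l : list J) (w : J -> R -> (X -> R) -> R) (v : J -> X) :
  (forall j, In j l -> contR D (w j)) -> cont2 D (fun u t => comb l (fun j => w j u t) v).
Proof.
  intros H. apply cont2_coord with (map v l).
  - intros u t x _ Hx. apply lsum_0. intros j Hj. destruct (ceq_dec (v j) x) as [<-|]; auto.
    destruct Hx. apply in_map; auto.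
  - intros x _. unfold comb. apply contR_lsum. intros j Hj.
    destruct (ceq_dec (v j) x); auto. apply contR_const.
Qed.

(* On the subcomplex spanned by a finite vertex set the weak topology is the sup-metric one. *)
Lemma wopen_finite L U M y : down_closed L -> wopen X L U -> lands L M y -> U y ->
  exists eps, 0 < eps /\ forall y', lands L M y' -> close eps y y' -> U y'.
Proof.
  intros HL HU Hy HUy.
  destruct (fin_eps (sublists (nodup ceq_dec M)) (fun s e => L s -> in_cell X s y ->
     forall t', in_cell X s t' -> close e y t' -> U t')) as (e & He & H).
  { intros s e e' H He' Hs Hc t' Ht' Hcl. apply H; auto. apply close_mono with e'; auto; lra. }
  { intros s _. destruct (classic (L s /\ in_cell X s y)) as [[Hs Hc]|Hn].
    - destruct (HU s y Hs Hc HUy) as (e & He & H). exists e; split; auto.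
    - exists 1; split; [lra|]. tauto. }
  destruct (lands_supp _ _ _ HL Hy) as (Hs & Hi & Hc).
  destruct (fin_eps (supp y) (fun x e => e <= y x)) as (e' & He' & H').
  { intros; lra. }
  { intros x Hx. exists (y x). split; [|lra].
    assert (y x <> 0) by (apply (supp_spec _ _ Hc); auto).
    destruct Hc as (_ & Hp & _). specialize (Hp x). lra. }
  exists (Rmin e e'). split; [apply Rmin_pos; auto|].
  intros y' Hy' Hcl.
  destruct (lands_supp _ _ _ HL Hy') as (Hs' & Hi' & Hc').
  set (s := filter (fun x => dec (y' x <> 0)) (nodup ceq_dec M)).
  (* The vertices of y stay in the support of y', so one cell contains both. *)
  assert (Hsub : forall x, y x <> 0 -> y' x <> 0).
  { intros x Hx E. apply (supp_spec _ _ Hc) in Hx. specialize (H' x Hx).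
    specialize (Hcl x). rewrite E in Hcl. apply Rabs_def2 in Hcl.
    pose proof (Rmin_r e e'). lra. }
  assert (Hin : forall x, In x s <-> y' x <> 0).
  { intros x. unfold s. rewrite filter_In, decP, nodup_In. intuition.
    apply Hi'. apply (supp_spec _ _ Hc'); auto. }
  assert (Hnd : NoDup s) by (apply NoDup_filter, NoDup_nodup).
  assert (Hss : incl s (supp y')).
  { intros x Hx. apply (supp_spec _ _ Hc'), Hin; auto. }
  assert (Hcs' : in_cell X s y').
  { apply in_cell_change with (supp y'); auto. intros x; apply Hin. }
  apply (H s); auto.
  - apply filter_in_sublists.
  - apply HL with (supp y'); auto. intros E. rewrite E in Hcs'.
    destruct Hcs' as (_ & _ & _ & H1). simpl in H1. lra.
  - apply in_cell_change with (supp y); auto. intros x Hx. apply Hin; auto.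
  - apply close_mono with (Rmin e e'); auto. apply Rmin_l.
Qed.

(** Confining the image of each cell to a finite subcomplex turns sup-metric continuity on cells
    into weak continuity, by [wopen_finite]. The parameter set [I] lets maps and homotopies be
    treated together. *)
Definition carried (I : R -> Prop) K (Cr : list X -> complex X)
    (f : R -> (X -> R) -> X -> R) : Prop :=
  forall s, K s -> cont2 (fun u t => I u /\ in_cell X s t) f /\
    exists M, forall u t, I u -> in_cell X s t -> lands (Cr s) M (f u t).

Lemma carried_mono I K (Cr Cr' : list X -> complex X) f :
  (forall s s', K s -> Cr s s' -> Cr' s s') -> carried I K Cr f -> carried I K Cr' f.
Proof.
  intros H Hf s Hs. destruct (Hf s Hs) as [Hc [M HM]]. split; auto.
  exists M. intros u t Hu Ht. apply lands_mono with (Cr s) M; auto. apply incl_refl.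
Qed.

Lemma carried_nbhd I K L f U s u t : down_closed L -> carried I K (fun _ => L) f ->
  wopen X L U -> K s -> in_cell X s t -> I u -> U (f u t) ->
  near (fun u t => I u /\ in_cell X s t) u t (fun u' t' => U (f u' t')).
Proof.
  intros HL Hf HU Hs Ht Hu HUt. destruct (Hf s Hs) as [Hc [M HM]].
  destruct (wopen_finite L U M (f u t) HL HU (HM u t Hu Ht) HUt) as (e & He & H).
  eapply near_imp; [| |exact (Hc u t (conj Hu Ht) e He)]; auto.
  intros u' t' [Hu' Ht']. auto.
Qed.

Lemma carried_hcont K L f : down_closed L ->
  carried (fun u => 0 <= u <= 1) K (fun _ => L) f -> hcont X K L f.
Proof.
  intros HL Hf U HU s u t Hs Ht Hu HUt.
  destruct (carried_nbhd _ K L f U s u t HL Hf HU Hs Ht Hu HUt) as (e & He & H).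
  exists e; auto.
Qed.

Lemma carried_wcont K L f u : down_closed L ->
  carried (fun v => v = u) K (fun _ => L) f -> wcont X K L (f u).
Proof.
  intros HL Hf U HU s t Hs Ht HUt.
  destruct (carried_nbhd _ K L f U s u t HL Hf HU Hs Ht eq_refl HUt) as (e & He & H).
  exists e; split; auto. intros t' Ht' Hcl. apply (H u t'); auto.
  rewrite Rminus_diag, Rabs_R0; auto.
Qed.

Lemma carried_real I K L f u t :
  carried I K (fun _ => L) f -> I u -> in_real X K t -> in_real X L (f u t).
Proof.
  intros Hf Hu (s & Hs & Ht). destruct (Hf s Hs) as [_ [M HM]].
  apply lands_real with M; auto.
Qed.

(** * Contractible carriers *)

(* A contraction of C cannot be chosen uniformly over infinitely many simplices; contracting
   its finite subcomplexes suffices for extending maps over cells. *)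
Definition fin_contractible C : Prop := forall M, exists M' c h,
  lands C M' c /\
  cont2 (fun u t => 0 <= u <= 1 /\ lands C M t) h /\
  (forall u t, 0 <= u <= 1 -> lands C M t -> lands C M' (h u t)) /\
  (forall t, lands C M t -> h 0 t = t) /\ (forall t, lands C M t -> h 1 t = c).

Lemma fin_incl {J} (l : list J) (Q : J -> list X -> Prop) :
  (forall j M M', Q j M -> incl M M' -> Q j M') ->
  (forall j, In j l -> exists M, Q j M) ->
  exists M, forall j, In j l -> Q j M.
Proof.
  intros Hm. induction l as [|a l IH]; intros H.
  - exists []; easy.
  - destruct IH as [M HM]; [intros; apply H; right; auto|].
    destruct (H a (or_introl eq_refl)) as [M' Ha].
    exists (M ++ M'). intros b [<-|Hb].
    + apply Hm with M'; auto. apply incl_appr, incl_refl.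
    + apply Hm with M; auto. apply incl_appl, incl_refl.
Qed.

Lemma in_cell_face s1 s2 x t : in_cell X (s1 ++ x :: s2) t -> t x = 0 -> in_cell X (s1 ++ s2) t.
Proof.
  intros H Hx. apply in_cell_change with (s1 ++ x :: s2); auto.
  - destruct H as [Hn _]. apply NoDup_remove_1 in Hn; auto.
  - intros z Hz. apply in_cell_In with (2 := Hz) in H. apply in_app_or in H.
    apply in_or_app. destruct H as [|[<-|]]; tauto.
Qed.

(** The seed 1 is harmless, since barycentric coordinates are at most 1. *)
Definition lmin s t : R := fold_right (fun x acc => Rmin (t x) acc) 1 s.

Lemma lmin_le s t x : In x s -> lmin s t <= t x.
Proof.
  induction s as [|a s IH]; simpl; intros H; [easy|].
  destruct H as [->|H]; [apply Rmin_l|].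
  apply Rle_trans with (lmin s t); auto. apply Rmin_r.
Qed.

Lemma lmin_attained s t : lmin s t = 1 \/ exists x, In x s /\ lmin s t = t x.
Proof.
  induction s as [|a s IH]; simpl; auto.
  fold (lmin s t). unfold Rmin. destruct Rle_dec; eauto.
  destruct IH as [IH|(x & Hx & IH)]; eauto.
Qed.

Lemma contR_lmin D s : contR D (fun _ t => lmin s t).
Proof.
  induction s as [|a s IH]; simpl; [apply contR_const|].
  apply (contR_min D (fun _ t => t a) (fun _ t => lmin s t)); auto. apply contR_coord.
Qed.

(** * Extension over prisms, cell by cell *)

Section Carrier.
Variables (A : complex X) (Cr : list X -> complex X) (I : R -> Prop).
Variable e : R -> (X -> R) -> X -> R.
Hypothesis HA : down_closed A.
Hypothesis Cr_mono : forall s s', A s -> A s' -> incl s s' -> forall s0, Cr s s0 -> Cr s' s0.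
Hypothesis Cr_contr : forall s, A s -> fin_contractible (Cr s).
Hypothesis I01 : forall u, I u -> 0 <= u <= 1.
(** The time component of the retraction to the boundary of a prism must stay in [I]. This is so for
    [[0,1]] and for the single point 1/2, the two sets used. *)
Hypothesis I_retract : forall u m, I u -> 0 <= m -> m <= 2 * u -> m <= 2 - 2 * u -> m < 1 ->
  I ((u - m / 2) / (1 - m)).

Definition ends (u : R) : Prop := u = 0 \/ u = 1.

Hypothesis He : carried (fun u => I u /\ ends u) A Cr e.

Definition prism s (u : R) t : Prop := I u /\ in_cell X s t.

Definition on_cell s f : Prop :=
  cont2 (prism s) f /\ (exists M, forall u t, prism s u t -> lands (Cr s) M (f u t)) /\
  (forall u t, prism s u t -> ends u -> f u t = e u t).

(* depth is 0 on the boundary of the prism I x s and 1 at its centre, and each point is the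
   combination, with weights 1 - depth and depth, of its retraction and the centre. *)
Definition depth s u t : R :=
  Rmin (Rmin (2 * u) (2 - 2 * u)) (INR (length s) * lmin s t).

Definition retract_u (m u : R) : R := (u - m / 2) / (1 - m).
Definition retract_t s (m : R) t : X -> R :=
  fun x => if excluded_middle_informative (In x s)
           then (t x - m / INR (length s)) / (1 - m) else 0.

Definition bd s u t : Prop := prism s u t /\ (ends u \/ exists x, In x s /\ t x = 0).

Lemma length_pos s t : in_cell X s t -> 0 < INR (length s).
Proof.
  intros (_ & _ & _ & H). apply lt_0_INR. destruct s; simpl in *; [lra|lia].
Qed.

Lemma depth_le s u t x : in_cell X s t -> In x s -> depth s u t / INR (length s) <= t x.
Proof.
  intros Ht Hx. pose proof (length_pos s t Ht) as Hl.
  apply Rle_trans with (lmin s t); [|apply lmin_le; auto].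
  apply Rmult_le_reg_r with (INR (length s)); auto.
  unfold Rdiv. rewrite Rmult_assoc, Rinv_l, Rmult_1_r, Rmult_comm by lra. apply Rmin_r.
Qed.

Lemma lmin_ge0 s t : in_cell X s t -> 0 <= lmin s t.
Proof.
  intros (_ & Hp & _). destruct (lmin_attained s t) as [->|(x & _ & ->)]; auto; lra.
Qed.

Lemma depth_bounds s u t : prism s u t ->
  0 <= depth s u t /\ depth s u t <= 2 * u /\ depth s u t <= 2 - 2 * u /\ depth s u t <= 1.
Proof.
  intros [Hu Ht]. pose proof (I01 u Hu). pose proof (length_pos s t Ht).
  pose proof (lmin_ge0 s t Ht).
  assert (0 <= INR (length s) * lmin s t) by (apply Rmult_le_pos; lra).
  unfold depth, Rmin. repeat destruct Rle_dec; lra.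
Qed.

Lemma retract_bd s u t : prism s u t -> depth s u t < 1 ->
  bd s (retract_u (depth s u t) u) (retract_t s (depth s u t) t).
Proof.
  intros Hp Hm. destruct (depth_bounds s u t Hp) as (H0 & H1 & H2 & _).
  destruct Hp as [Hu Ht]. pose proof (length_pos s t Ht) as Hl.
  pose proof (fun x => depth_le s u t x Ht) as Hd.
  (* The term attaining the minimum decides which face is hit: the bottom, the top, or the lateral
     face where a smallest coordinate becomes 0. *)
  assert (E : depth s u t = 2 * u \/ depth s u t = 2 - 2 * u \/
    depth s u t = INR (length s) * lmin s t).
  { unfold depth, Rmin. repeat destruct Rle_dec; auto. }
  set (m := depth s u t) in *. clearbody m.
  split; [split|].
  - apply I_retract; auto.
  - split; [|split; [|split]].
    + apply Ht.
    + intros x. unfold retract_t. destruct excluded_middle_informative as [Hx|]; [|lra].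
      apply Rdiv_le_0_compat; [|lra]. specialize (Hd x Hx). lra.
    + intros x Hx. unfold retract_t. destruct excluded_middle_informative; easy.
    + change (lsum s (retract_t s m t) = 1).
      rewrite (lsum_ext s _ (fun x => / (1 - m) * (t x + - (m / INR (length s))))).
      * rewrite lsum_scal, lsum_plus, lsum_const.
        destruct Ht as (_ & _ & _ & Ht). change (lsum s t = 1) in Ht. rewrite Ht.
        field; lra.
      * intros x Hx. unfold retract_t. destruct excluded_middle_informative; [|easy].
        field; lra.
  - unfold ends, retract_u. destruct E as [E|[E|E]].
    + left; left. rewrite E. field; lra.
    + left; right. rewrite E. field; lra.
    + right. destruct (lmin_attained s t) as [El|(x & Hx & El)].
      (* The seed value of [lmin] would make the depth at least 1. *)
      * exfalso. rewrite El, Rmult_1_r in E.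
        assert (1 <= INR (length s)); [|lra].
        apply (le_INR 1). destruct s; simpl in *; [lra|lia].
      * exists x; split; auto. unfold retract_t.
        destruct excluded_middle_informative; [|easy].
        rewrite El in E. rewrite E. field; lra.
Qed.

Lemma depth_boundary s u t : bd s u t -> depth s u t = 0.
Proof.
  intros [Hp H]. destruct (depth_bounds s u t Hp) as (H0 & H1 & H2 & _).
  destruct Hp as [Hu Ht]. destruct H as [[E|E]|(x & Hx & H)]; [lra|lra|].
  pose proof (depth_le s u t x Ht Hx) as Hd. pose proof (length_pos s t Ht).
  rewrite H in Hd. apply Rle_antisym; auto.
  apply Rmult_le_reg_r with (/ INR (length s)); [apply Rinv_0_lt_compat; auto|].
  rewrite Rmult_0_l. apply Hd.
Qed.

Lemma contR_depth D s : contR D (depth s).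
Proof.
  apply (contR_min D (fun u _ => Rmin (2 * u) (2 - 2 * u)) (fun _ t => INR (length s) * lmin s t)).
  - apply (contR_min D (fun u _ => 2 * u) (fun u _ => 2 - 2 * u)).
    + apply (contR_mult D (fun _ _ => 2) (fun u _ => u)); [apply contR_const|apply contR_time].
    + apply (contR_minus D (fun _ _ => 2) (fun u _ => 2 * u)); [apply contR_const|].
      apply (contR_mult D (fun _ _ => 2) (fun u _ => u)); [apply contR_const|apply contR_time].
  - apply (contR_mult D (fun _ _ => INR (length s)) (fun _ t => lmin s t));
      [apply contR_const|apply contR_lmin].
Qed.

Definition skeleton_ok (n : nat) f : Prop :=
  forall s, A s -> (length s <= n)%nat -> on_cell s f.

(** The boundary data are [e] on the two ends and [f] on the lateral faces; they fit together
    because [f] already equals [e] on the ends of smaller prisms. *)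
Lemma boundary_map n f s : skeleton_ok n f -> A s -> length s = S n ->
  exists g, cont2 (bd s) g /\ (exists M, forall u t, bd s u t -> lands (Cr s) M (g u t)) /\
    (forall u t, prism s u t -> ends u -> g u t = e u t) /\
    (forall u t, prism s u t -> (exists x, In x s /\ t x = 0) -> g u t = f u t).
Proof.
  intros Hf Hs Hl.
  (* The face opposite [x] is empty when [s] is a single vertex, so [A s'] is claimed only once the
     prism over [s'] has a point. *)
  assert (Hface : forall x, In x s -> exists s',
    (forall u t, prism s u t -> t x = 0 -> prism s' u t) /\
    (forall u t, prism s' u t -> A s' /\ on_cell s' f) /\ (incl s' s)).
  { intros x Hx. destruct (in_split _ _ Hx) as (s1 & s2 & E). exists (s1 ++ s2).
    assert (Hi : incl (s1 ++ s2) s).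
    { rewrite E. intros z Hz. apply in_app_or in Hz. apply in_or_app; simpl; tauto. }
    split; [|split]; auto.
    - intros u t [Hu Ht] H0. split; auto. rewrite E in Ht. apply in_cell_face with x; auto.
    - intros u t [Hu Ht].
      assert (HA' : A (s1 ++ s2)).
      { apply HA with s; auto. intros E'. rewrite E' in Ht.
        destruct Ht as (_ & _ & _ & H1). simpl in H1; lra. }
      split; auto. apply Hf; auto. rewrite E, length_app in Hl. simpl in Hl.
      rewrite length_app. lia. }
  assert (Hfe : forall u t x, prism s u t -> In x s -> t x = 0 -> ends u -> f u t = e u t).
  { intros u t x Hp Hx H0 Hu. destruct (Hface x Hx) as (s' & H1 & H2 & _).
    specialize (H1 u t Hp H0). destruct (H2 u t H1) as [_ (_ & _ & H3)]. auto. }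
  exists (fun u t => if excluded_middle_informative (ends u) then e u t else f u t).
  destruct (He s Hs) as [Hec [Me HMe]].
  split; [|split; [|split]].
  - apply cont2_paste with (None :: map Some s)
      (* [None] stands for both ends, [Some x] for the face opposite [x]. On the prism the
         inequalities amount to equalities, in the closed form that [rclosed_le] handles. *)
      (fun o u t => match o with None => u * (1 - u) <= 0 | Some x => t x <= 0 end).
    + intros u t [Hp [Hu|(x & Hx & H0)]].
      * exists None; split; [left; auto|]. destruct Hu as [-> | ->]; lra.
      * exists (Some x); split; [right; apply in_map; auto|]. lra.
    + intros [x|] _.
      * apply (rclosed_le _ (fun _ t => t x)), contR_coord.
      * apply (rclosed_le _ (fun u _ => u * (1 - u))).
        apply (contR_mult _ (fun u _ => u) (fun u _ => 1 - u)); [apply contR_time|].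
        apply (contR_minus _ (fun _ _ => 1) (fun u _ => u)); [apply contR_const|apply contR_time].
    + intros [x|] Ho.
      * destruct Ho as [Ho|Ho]; [easy|]. apply in_map_iff in Ho as (x' & Ex & Hx).
        injection Ex as ->. destruct (Hface x Hx) as (s' & H1 & H2 & _).
        destruct (classic (exists u t, prism s' u t)) as [(u0 & t0 & Hp0)|Hn].
        -- destruct (H2 _ _ Hp0) as [_ (Hc & _)].
           assert (Hz : forall u t, bd s u t /\ t x <= 0 -> prism s u t /\ t x = 0).
           { intros u t [[Hp _] H]. split; auto. destruct Hp as [_ (_ & Hp & _)].
             specialize (Hp x); lra. }
           apply cont2_sub with (1 := Hc); intros u t H; apply Hz in H as [Hp H]; auto.
           destruct excluded_middle_informative as [Hu|]; auto. apply (Hfe u t x); auto.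
        -- intros u t [[Hp _] H]. exfalso. apply Hn. exists u, t. apply H1; auto.
           destruct Hp as [_ (_ & Hp & _)]. specialize (Hp x); lra.
      * assert (Hz : forall u t, bd s u t /\ u * (1 - u) <= 0 ->
          (I u /\ ends u) /\ in_cell X s t).
        { intros u t [[[Hu Ht] _] H]. split; auto. split; auto.
          pose proof (I01 u Hu). unfold ends. nra. }
        apply cont2_sub with (1 := Hec); auto.
        intros u t H; apply Hz in H as [[_ Hu] _].
        destruct excluded_middle_informative; easy.
  - assert (HMf : exists M, forall x, In x s -> forall u t, prism s u t -> t x = 0 ->
      lands (Cr s) M (f u t)).
    { apply (fin_incl s (fun x M => forall u t, prism s u t -> t x = 0 -> lands (Cr s) M (f u t))).
      - intros x M M' H Hi u t Hp H0. apply lands_mono with (Cr s) M; auto.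
      - intros x Hx. destruct (Hface x Hx) as (s' & H1 & H2 & H3).
        destruct (classic (exists u t, prism s' u t)) as [(u0 & t0 & Hp0)|Hn].
        + destruct (H2 _ _ Hp0) as [Hs' (_ & (M & HM) & _)]. exists M.
          intros u t Hp H0. apply lands_mono with (Cr s') M; auto; [|apply incl_refl].
          intros s0. apply Cr_mono; auto.
        + exists []. intros u t Hp H0. exfalso. apply Hn. exists u, t. auto. }
    destruct HMf as [Mf HMf]. exists (Me ++ Mf). intros u t [Hp H].
    destruct excluded_middle_informative as [Hu|Hu].
    + destruct Hp as [Hi Ht]. apply lands_mono with (Cr s) Me; auto. apply incl_appl, incl_refl.
    + destruct H as [H|(x & Hx & H)]; [easy|].
      apply lands_mono with (Cr s) Mf; [auto|apply incl_appr, incl_refl|]. apply HMf with x; auto.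
  - intros u t _ Hu. destruct excluded_middle_informative; easy.
  - intros u t Hp (x & Hx & H). destruct excluded_middle_informative; auto.
    symmetry. apply (Hfe u t x); auto.
Qed.

(** The prism is filled by a cone: at depth m <= 1/2 the boundary value at the retracted point is
    moved along the contraction [h] for time 2m, and deeper points go to its end [c]. Stopping at
    1/2 keeps the denominator 1 - m of the retraction away from 0. *)
Lemma extend_cell n f s : skeleton_ok n f -> A s -> length s = S n ->
  exists g, on_cell s g /\
    forall u t, prism s u t -> (exists x, In x s /\ t x = 0) -> g u t = f u t.
Proof.
  intros Hf Hs Hl.
  destruct (boundary_map n f s Hf Hs Hl) as (b & Hb & (M & HM) & Hbe & Hbf).
  destruct (Cr_contr s Hs M) as (M' & c & h & Hc & Hh & HM' & Hh0 & Hh1).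
  set (G := fun u t => let m := depth s u t in
    h (2 * m) (b (retract_u m u) (retract_t s m t))).
  set (g := fun u t => if Rle_dec (1 / 2) (depth s u t) then c else G u t).
  assert (HG : forall u t, prism s u t -> depth s u t <= 1 / 2 -> g u t = G u t).
  { intros u t Hp Hm. unfold g. destruct Rle_dec as [Hm'|]; auto.
    assert (E : depth s u t = 1 / 2) by lra.
    unfold G. cbv zeta. rewrite E. replace (2 * (1 / 2)) with 1 by field.
    rewrite Hh1; auto. apply HM. rewrite <- E. apply retract_bd; auto. lra. }
  assert (Hbd : forall u t, bd s u t -> g u t = b u t).
  { intros u t H. rewrite HG; [|apply H|rewrite depth_boundary; auto; lra].
    unfold G. cbv zeta. rewrite depth_boundary, Rmult_0_r; auto.
    replace (retract_u 0 u) with u by (unfold retract_u; field).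
    replace (retract_t s 0 t) with t.
    - apply Hh0, HM; auto.
    - apply functional_extensionality; intros x. unfold retract_t.
      destruct H as [[_ Ht] _]. pose proof (length_pos s t Ht).
      destruct excluded_middle_informative; [field; lra|]. apply Ht; auto. }
  exists g. split; [split; [|split]|].
  - apply cont2_paste with [true; false] (fun (i : bool) u t =>
      if i then depth s u t <= 1 / 2 else 1 - depth s u t <= 1 / 2).
    + intros u t _. destruct (Rle_dec (depth s u t) (1 / 2)).
      * exists true; simpl; auto.
      * exists false; simpl; split; auto; lra.
    + intros [|] _.
      * apply rclosed_le, contR_depth.
      * apply (rclosed_le _ (fun u t => 1 - depth s u t)).
        apply (contR_minus _ (fun _ _ => 1) (depth s)); [apply contR_const|apply contR_depth].
    + intros [|] _.
      * apply cont2_sub with (D := fun u t => prism s u t /\ depth s u t <= 1 / 2) (f := G); auto.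
        2: intros u t [Hp H]; symmetry; auto.
        set (D := fun u t => prism s u t /\ depth s u t <= 1 / 2).
        assert (HD : forall u t, D u t -> 1 - depth s u t <> 0) by (intros u t [_ H]; lra).
        assert (HDb : forall u t, D u t ->
          bd s (retract_u (depth s u t) u) (retract_t s (depth s u t) t)).
        { intros u t [Hp H]. apply retract_bd; auto; lra. }
        assert (Hm : contR D (fun u t => 1 - depth s u t)).
        { apply (contR_minus _ (fun _ _ => 1) (depth s)); [apply contR_const|apply contR_depth]. }
        apply (cont2_comp D (fun u t => 0 <= u <= 1 /\ lands (Cr s) M t)
          (fun u t => 2 * depth s u t)
          (fun u t => b (retract_u (depth s u t) u) (retract_t s (depth s u t) t))); auto.
        -- apply (contR_mult _ (fun _ _ => 2) (depth s)); [apply contR_const|apply contR_depth].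
        -- apply (cont2_comp D (bd s) (fun u t => retract_u (depth s u t) u)
             (fun u t => retract_t s (depth s u t) t)); auto.
           ++ apply (contR_div _ (fun u t => u - depth s u t / 2) (fun u t => 1 - depth s u t)); auto.
              apply (contR_minus _ (fun u _ => u) (fun u t => depth s u t / 2)); [apply contR_time|].
              apply (contR_mult _ (depth s) (fun _ _ => / 2)); [apply contR_depth|apply contR_const].
           ++ apply cont2_coord with s.
              ** intros u t x _ Hx. unfold retract_t. destruct excluded_middle_informative; easy.
              ** intros x Hx. unfold retract_t. destruct excluded_middle_informative; [|easy].
                 apply (contR_div _ (fun u t => t x - depth s u t / INR (length s))
                   (fun u t => 1 - depth s u t)); auto.
                 apply (contR_minus _ (fun _ t => t x) (fun u t => depth s u t / INR (length s)));
                   [apply contR_coord|].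
                 apply (contR_mult _ (depth s) (fun _ _ => / INR (length s)));
                   [apply contR_depth|apply contR_const].
        -- intros u t H. split; [|apply HM; auto].
           destruct H as [Hp H]. destruct (depth_bounds s u t Hp). lra.
      * apply cont2_sub with (D := fun _ _ => True) (f := fun _ _ => c); auto.
        -- intros u t _ eps Heps. exists 1; split; [lra|]. intros u' t' _ _ _ x.
           rewrite Rminus_diag, Rabs_R0; auto.
        -- intros u t [_ H]. unfold g. destruct Rle_dec; auto; lra.
  - exists M'. intros u t Hp. destruct (Rle_dec (1 / 2) (depth s u t)) as [H|H].
    + unfold g. destruct Rle_dec; easy.
    + rewrite HG; auto; [|lra]. destruct (depth_bounds s u t Hp).
      apply HM'; [lra|]. apply HM, retract_bd; auto; lra.
  - intros u t Hp Hu. rewrite Hbd, Hbe; auto. split; auto.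
  - intros u t Hp Hx. rewrite Hbd, Hbf; auto. split; auto.
Qed.

Lemma supp_length_le s t : in_cell X s t -> (length (supp t) <= length s)%nat.
Proof.
  intros H. destruct (in_cell_supp s t H) as ((Hn & _) & Hi & _).
  apply NoDup_incl_length; auto.
Qed.

(** The new map must depend on the point alone, whereas a simplex occurs as several lists. So a
    filling is chosen for every list but used only for the canonical list [supp t]. *)
Lemma extend_skeleton n f : skeleton_ok n f -> exists g, skeleton_ok (S n) g /\
  forall u t, (length (supp t) <= n)%nat -> g u t = f u t.
Proof.
  intros Hf.
  assert (H : forall s, exists g, A s -> length s = S n -> on_cell s g /\
    forall u t, prism s u t -> (exists x, In x s /\ t x = 0) -> g u t = f u t).
  { intros s. destruct (classic (A s /\ length s = S n)) as [[Hs Hl]|Hn].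
    - destruct (extend_cell n f s Hf Hs Hl) as [g Hg]. exists g; auto.
    - exists f. tauto. }
  pose (F := fun s => proj1_sig (constructive_indefinite_description _ (H s))).
  assert (HF : forall s, A s -> length s = S n -> on_cell s (F s) /\
    forall u t, prism s u t -> (exists x, In x s /\ t x = 0) -> F s u t = f u t).
  { intros s. unfold F. apply proj2_sig. }
  clearbody F. clear H.
  exists (fun u t => if le_dec (length (supp t)) n then f u t else F (supp t) u t).
  split; [|intros u t Ht; destruct le_dec; easy].
  assert (Hsame : forall s s' g, A s -> A s' -> (forall x, In x s <-> In x s') ->
    (forall u t, prism s u t -> prism s' u t) -> on_cell s' g -> on_cell s g).
  { intros s s' g Hs Hs' Hss Hp (H1 & (M & HM) & H3). split; [|split]; auto.
    - apply cont2_sub with (1 := H1); auto.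
    - exists M. intros u t Hut. apply lands_mono with (Cr s') M; auto; [|apply incl_refl].
      intros s0. apply Cr_mono; auto. intros x; apply Hss. }
  assert (Hext : forall s g g', on_cell s g -> (forall u t, prism s u t -> g u t = g' u t) ->
    on_cell s g').
  { intros s g g' (H1 & (M & HM) & H3) E. split; [|split].
    - apply cont2_sub with (1 := H1); auto.
    - exists M. intros u t Hp. rewrite <- E; auto.
    - intros u t Hp Hu. rewrite <- E; auto. }
  intros s Hs Hl. destruct (le_lt_dec (length s) n) as [Hn|Hn].
  - apply Hext with f; auto. intros u t [_ Ht]. pose proof (supp_length_le s t Ht).
    destruct le_dec; auto; lia.
  - assert (El : length s = S n) by lia.
    destruct (classic (NoDup s)) as [Hnd|Hnd].
    2: { assert (Hno : forall u t, ~ prism s u t) by (intros u t [_ [Hc _]]; auto).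
         split; [|split].
         - intros u t Hp. destruct (Hno _ _ Hp).
         - exists []. intros u t Hp. destruct (Hno _ _ Hp).
         - intros u t Hp. destruct (Hno _ _ Hp). }
    set (s' := listing (fun x => In x s)).
    destruct (listing_spec (fun x => In x s) s (fun x Hx => Hx)) as [Hnd' Hin]. fold s' in Hnd', Hin.
    assert (Hl' : length s' = S n).
    { rewrite <- El. apply Permutation_length, NoDup_Permutation; auto. }
    assert (Hs' : A s').
    { apply HA with s; auto.
      - intros E; rewrite E in Hl'; easy.
      - intros x; apply Hin. }
    assert (Hp : forall u t, prism s u t -> prism s' u t).
    { intros u t [Hu Ht]. split; auto. apply in_cell_change with s; auto.
      intros x Hx. apply Hin. apply in_cell_In with t; auto. }
    destruct (HF s' Hs' Hl') as [Hc Hface].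
    apply Hsame with s'; auto.
    { intros x. symmetry; auto. }
    apply Hext with (F s'); auto. intros u t [Hu Ht].
    destruct (supp_spec _ _ Ht) as [Hsn Hsi].
    destruct le_dec as [Hle|Hle].
    + apply Hface; [split; auto|]. apply NNPP. intros Hno.
      assert (Hi : incl s' (supp t)).
      { intros x Hx. apply Hsi. intros E. apply Hno. exists x; auto. }
      apply NoDup_incl_length in Hi; auto. lia.
    (* A support with more than [n] vertices inside the [n + 1] vertices of [s] is all of [s]. *)
    + f_equal. apply listing_ext. intros x. rewrite <- Hsi. rewrite <- Hin. split; intros Hx.
      * apply Hin in Hx. apply NNPP. intros Hno.
        destruct (in_split _ _ Hx) as (s1 & s2 & Es).
        assert (Hi : incl (supp t) (s1 ++ s2)).
        { intros z Hz. pose proof (proj1 (Hsi z) Hz) as Hz'.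
          apply in_cell_In with (1 := Ht) in Hz'. apply Hin in Hz'.
          assert (z <> x) by (intros ->; auto).
          rewrite Es in Hz'. apply in_app_or in Hz'. apply in_or_app.
          destruct Hz' as [|[|]]; auto. congruence. }
        apply NoDup_incl_length in Hi; auto. rewrite Es, length_app in El. simpl in El.
        rewrite length_app in Hi. lia.
      * apply in_cell_In with (1 := Ht). apply Hsi; auto.
Qed.

(** A point is evaluated at the stage given by the size of its own support; later stages leave it
    unchanged, so the stages have a limit. *)
Lemma carrier_extension : exists H, carried I A Cr H /\
  forall u t, I u -> ends u -> in_real X A t -> H u t = e u t.
Proof.
  assert (H0 : skeleton_ok 0 e).
  { intros s Hs Hl. assert (s = []) by (destruct s; simpl in Hl; auto; lia). subst s.
    assert (Hno : forall u t, ~ prism [] u t).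
    { intros u t [_ (_ & _ & _ & H1)]. simpl in H1. lra. }
    split; [|split].
    - intros u t Hp. destruct (Hno _ _ Hp).
    - exists []. intros u t Hp. destruct (Hno _ _ Hp).
    - intros u t Hp. destruct (Hno _ _ Hp). }
  pose (G := fix G (n : nat) : {f | skeleton_ok n f} :=
    match n with
    | O => exist _ e H0
    | S n' => let p := constructive_indefinite_description _
                (extend_skeleton n' (proj1_sig (G n')) (proj2_sig (G n'))) in
              exist _ (proj1_sig p) (proj1 (proj2_sig p))
    end).
  assert (HG : forall n u t, (length (supp t) <= n)%nat ->
    proj1_sig (G (S n)) u t = proj1_sig (G n) u t).
  { intros n u t Hl. simpl. destruct constructive_indefinite_description as [g [Hg Ha]].
    simpl. auto. }
  assert (HG' : forall n u t, (length (supp t) <= n)%nat ->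
    proj1_sig (G (length (supp t))) u t = proj1_sig (G n) u t).
  { intros n u t Hl. induction Hl as [|n Hl IH]; auto. rewrite HG; auto. }
  exists (fun u t => proj1_sig (G (length (supp t))) u t). split.
  - intros s Hs. destruct (proj2_sig (G (length s)) s Hs (le_n _)) as (H1 & (M & HM) & _).
    assert (E : forall u t, prism s u t ->
      proj1_sig (G (length s)) u t = proj1_sig (G (length (supp t))) u t).
    { intros u t [_ Ht]. symmetry. apply HG', supp_length_le; auto. }
    split.
    + apply cont2_sub with (1 := H1); auto.
    + exists M. intros u t Hu Ht. rewrite <- E by (split; auto). apply HM; split; auto.
  - intros u t Hu Hends (s & Hs & Ht).
    destruct (proj2_sig (G (length s)) s Hs (le_n _)) as (_ & _ & H3).
    rewrite HG' with (n := length s) by (apply supp_length_le; auto). apply H3; auto. split; auto.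
Qed.

End Carrier.
End Realization.

(** * Contractible complexes *)

(** The tent function, whose integer translates are the weights of piecewise linear
    interpolation. *)
Definition hat (v : R) : R := Rmax 0 (Rmin (1 + v) (1 - v)).

Lemma hat_ge0 v : 0 <= hat v.
Proof. apply Rmax_l. Qed.

Lemma hat_far v : v <= -1 \/ 1 <= v -> hat v = 0.
Proof. unfold hat, Rmax, Rmin. repeat destruct Rle_dec; lra. Qed.

Lemma hat_0 : hat 0 = 1.
Proof. unfold hat, Rmax, Rmin. repeat destruct Rle_dec; lra. Qed.

Lemma hat_far_nat i j : i <> j -> hat (INR i - INR j) = 0.
Proof.
  intros H. apply hat_far. destruct (Nat.lt_total i j) as [Hl|[Hl|Hl]]; [|easy|].
  - left. apply (le_INR (S _)) in Hl. rewrite S_INR in Hl. lra.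
  - right. apply (le_INR (S _)) in Hl. rewrite S_INR in Hl. lra.
Qed.

Lemma hat_partition N v : 0 <= v <= INR N -> lsum (seq 0 (S N)) (fun i => hat (v - INR i)) = 1.
Proof.
  revert v. induction N as [|N IH]; intros v Hv.
  - simpl in *. replace (v - 0) with 0 by lra. rewrite hat_0. ring.
  - rewrite seq_S, lsum_app. cbn [lsum fold_right Nat.add]. rewrite Rplus_0_r, S_INR.
    rewrite S_INR in Hv. destruct (Rle_dec v (INR N)) as [H|H].
    + rewrite IH by lra. rewrite hat_far; lra.
    + rewrite seq_S, lsum_app. cbn [lsum fold_right Nat.add]. rewrite lsum_0.
      * unfold hat, Rmax, Rmin. repeat destruct Rle_dec; lra.
      * intros i Hi. apply in_seq in Hi. apply hat_far. right.
        assert (INR (S i) <= INR N) by (apply le_INR; lia). rewrite S_INR in *. lra.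
Qed.

Lemma unit_interval_of N v : (0 < N)%nat -> 0 <= v <= INR N ->
  exists k, (k < N)%nat /\ INR k <= v <= INR k + 1.
Proof.
  induction N as [|N IH]; intros H Hv; [lia|].
  destruct N as [|N]; [exists O; split; [lia|simpl in *; lra]|].
  destruct (Rle_dec v (INR (S N))) as [Hl|Hl].
  - destruct IH as (k & Hk & Hkv); [lia|lra|]. exists k; split; auto.
  - exists (S N). split; [lia|]. rewrite (S_INR (S N)) in Hv. lra.
Qed.

Section Flow.
Context {X : Type}.
Implicit Types (t : X -> R) (s M : list X) (C K L : complex X).

(* Straight-line homotopies between the simplicial maps h (i/N) and h ((i+1)/N), with N
   depending on the finite subcomplex. *)
Lemma fin_contractible_of_flow C (h : R -> X -> X) p : down_closed C -> C [p] ->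
  (forall x, C [x] -> h 0 x = x /\ h 1 x = p) ->
  (forall s, C s -> exists eps, 0 < eps /\ forall a b, 0 <= a <= 1 -> 0 <= b <= 1 ->
     Rabs (a - b) < eps -> C (map (h a) s ++ map (h b) s)) ->
  fin_contractible C.
Proof.
  intros HC Hp Hends Hflow M.
  set (M0 := nodup ceq_dec M).
  destruct (fin_eps (sublists M0) (fun s eps => C s -> forall a b, 0 <= a <= 1 -> 0 <= b <= 1 ->
     Rabs (a - b) < eps -> C (map (h a) s ++ map (h b) s))) as (eps & Heps & HM).
  { intros s e e' H He Hs a b Ha Hb Hab. apply H; auto; lra. }
  { intros s _. destruct (classic (C s)) as [Hs|Hs].
    - destruct (Hflow s Hs) as (e & He & H). exists e; auto.
    - exists 1; split; [lra|easy]. }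
  destruct (archimed_cor1 eps Heps) as (N & HN & HN0).
  assert (HNR : 0 < INR N) by (apply lt_0_INR; auto).
  set (J := list_prod M0 (seq 0 (S N))).
  set (v := fun j : X * nat => h (INR (snd j) / INR N) (fst j)).
  (* The weight of a vertex is spread over its positions at the two grid times next to [u]; by the
     choice of [N] all positions involved span a simplex. *)
  set (w := fun (j : X * nat) (u : R) t => t (fst j) * hat (INR N * u - INR (snd j))).
  assert (HM0 : forall t, lands C M t -> NoDup M0 /\ in_cell X M0 t).
  { intros t Ht. destruct (lands_supp C M t HC Ht) as (_ & Hi & Hc). split; [apply NoDup_nodup|].
    apply in_cell_change with (supp t); auto; [apply NoDup_nodup|].
    intros x Hx. apply nodup_In, Hi. apply in_cell_In with t; auto. }
  assert (HCx : forall t x, lands C M t -> t x <> 0 -> C [x]).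
  { intros t x (s & Hs & _ & Hc) Hx. apply HC with s; [auto|easy|].
    intros z [<-|[]]. apply in_cell_In with t; auto. }
  (* At a grid time one tent survives, and the homotopy is the simplicial map induced by
     [h (i/N)]. *)
  assert (Hpt : forall t i (y : X), (i <= N)%nat ->
    comb J (fun j => w j (INR i / INR N) t) v y
    = lsum M0 (fun x => if ceq_dec (h (INR i / INR N) x) y then t x else 0)).
  { intros t i y Hi. unfold comb, J. rewrite lsum_list_prod. apply lsum_ext. intros x _.
    rewrite (lsum_ext _ _ (fun k => if ceq_dec i k then
      (if ceq_dec (h (INR i / INR N) x) y then t x else 0) else 0)).
    - apply lsum_indicator; [apply seq_NoDup|]. apply in_seq; lia.
    - intros k _. unfold w, v; simpl.
      replace (INR N * (INR i / INR N)) with (INR i) by (field; lra).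
      destruct (ceq_dec i k) as [<-|Hik].
      + rewrite Rminus_diag, hat_0, Rmult_1_r. reflexivity.
      + rewrite hat_far_nat, Rmult_0_r by auto. destruct ceq_dec; reflexivity. }
  exists (p :: map v J), (comb [tt] (fun _ => 1) (fun _ => p)),
    (fun u t => comb J (fun j => w j u t) v).
  split; [|split; [|split; [|split]]].
  - apply lands_comb with [p]; auto.
    + intros x [<-|[]]; simpl; auto.
    + intros; lra.
    + simpl; ring.
    + simpl; auto.
  - apply cont2_comb. intros [x i] _. unfold w; simpl.
    apply (contR_mult _ (fun _ t => t x)); [apply contR_coord|]. unfold hat.
    assert (Hl : forall D, contR D (fun u (_ : X -> R) => INR N * u - INR i)).
    { intros D. apply (contR_minus D (fun u _ => INR N * u) (fun _ _ => INR i)); [|apply contR_const].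
      apply (contR_mult D (fun _ _ => INR N) (fun u _ => u)); [apply contR_const|apply contR_time]. }
    apply contR_max; [apply contR_const|]. apply contR_min.
    + apply (contR_plus _ (fun _ _ => 1)); [apply contR_const|auto].
    + apply (contR_minus _ (fun _ _ => 1)); [apply contR_const|auto].
  - intros u t Hu Ht. destruct (HM0 t Ht) as [Hnd Hcell].
    destruct (unit_interval_of N (INR N * u)) as (k & Hk & Hku); [auto|nra|].
    (* The support of [t], rewritten as a sublist of [M0] so that the uniform [eps] applies. *)
    set (s := filter (fun x => dec (t x <> 0)) M0).
    assert (Hs : C s).
    { destruct (lands_supp C M t HC Ht) as (Hs & _ & Hc).
      destruct (supp_spec _ _ Hc) as [_ Hsi].
      apply HC with (supp t); auto.
      - intros E. destruct (in_cell_supp _ _ Hc) as (_ & _ & Hne).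
        destruct (supp t) as [|x l] eqn:Es; [easy|].
        assert (Hx : In x s); [|rewrite E in Hx; easy].
        assert (t x <> 0) by (apply Hsi; simpl; auto).
        apply filter_In. rewrite decP. split; auto. apply in_cell_In with t; auto.
      - intros x Hx. apply filter_In in Hx as [_ Hx]. apply Hsi, decP; auto. }
    apply lands_comb with (map (h (INR k / INR N)) s ++ map (h (INR (S k) / INR N)) s); auto.
    + apply HM; auto.
      * apply filter_in_sublists.
      * assert (INR k <= INR N) by (apply le_INR; lia). pose proof (pos_INR k).
        split; [apply Rdiv_le_0_compat; lra|apply Rle_div_l; lra].
      * assert (INR (S k) <= INR N) by (apply le_INR; lia). pose proof (pos_INR (S k)).
        split; [apply Rdiv_le_0_compat; lra|apply Rle_div_l; lra].
      * rewrite S_INR. replace (INR k / INR N - (INR k + 1) / INR N) with (- / INR N) by (field; lra).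
        rewrite Rabs_Ropp, Rabs_pos_eq; auto. apply Rlt_le, Rinv_0_lt_compat; auto.
    + intros y Hy. right. apply in_map_iff. apply in_app_or in Hy.
      destruct Hy as [Hy|Hy]; apply in_map_iff in Hy as (x & <- & Hx);
        apply filter_In in Hx as [Hx _].
      * exists (x, k). split; auto. apply in_prod; auto. apply in_seq; lia.
      * exists (x, S k). split; auto. apply in_prod; auto. apply in_seq; lia.
    + intros [x i] _. unfold w. apply Rmult_le_pos; [apply Hcell|apply hat_ge0].
    + unfold J. rewrite lsum_list_prod. unfold w; cbn [fst snd].
      rewrite (lsum_ext _ _ t).
      * apply Hcell.
      * intros x _. rewrite lsum_scal, hat_partition; [ring|]. split; nra.
    + intros [x i] Hj Hw. apply in_prod_iff in Hj as [Hx _]. unfold w in Hw; simpl in Hw.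
      assert (Hxs : In x s).
      { apply filter_In; split; auto. apply decP. intros E. rewrite E in Hw. lra. }
      assert (Hi : i = k \/ i = S k).
      { apply NNPP. intros Hn. apply Hw. rewrite (hat_far (INR N * u - INR i)); [ring|].
        assert (Hik : (i < k \/ S (S k) <= i)%nat) by lia. destruct Hik as [Hik|Hik].
        - right. apply (le_INR (S _)) in Hik. rewrite S_INR in Hik. lra.
        - left. apply le_INR in Hik. rewrite !S_INR in Hik. lra. }
      apply in_or_app. unfold v; simpl.
      destruct Hi as [->| ->]; [left|right]; apply in_map; auto.
  - intros t Ht. apply functional_extensionality; intros y.
    replace 0 with (INR 0 / INR N) by (simpl; field; lra).
    rewrite Hpt by lia. simpl (INR 0). unfold Rdiv. rewrite Rmult_0_l.
    destruct (HM0 t Ht) as [Hnd Hcell].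
    rewrite (lsum_ext _ _ (fun x => if ceq_dec y x then t y else 0)).
    + destruct (classic (In y M0)) as [Hy|Hy].
      * apply lsum_indicator; auto.
      * rewrite lsum_0; [symmetry; apply Hcell; auto|].
        intros x Hx. destruct (ceq_dec y x) as [->|]; easy.
    + intros x _. destruct (Req_dec (t x) 0) as [E|E].
      * rewrite E. destruct (ceq_dec y x) as [->|]; destruct ceq_dec; auto.
      * destruct (Hends x (HCx t x Ht E)) as [-> _].
        destruct (ceq_dec x y) as [->|]; destruct ceq_dec; auto; congruence.
  - intros t Ht. apply functional_extensionality; intros y.
    pose proof (Hpt t N y (le_n _)) as E. replace (INR N / INR N) with 1 in E by (field; lra).
    cbv beta. rewrite E. clear E.
    destruct (HM0 t Ht) as [Hnd Hcell].
    rewrite (lsum_ext _ _ (fun x => (if ceq_dec p y then 1 else 0) * t x)).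
    + rewrite lsum_scal. destruct Hcell as (_ & _ & _ & H1).
      change (lsum M0 t = 1) in H1. rewrite H1. unfold comb; simpl. ring.
    + intros x _. destruct (Req_dec (t x) 0) as [E|E].
      * rewrite E. destruct ceq_dec; ring.
      * destruct (Hends x (HCx t x Ht E)) as [_ ->]. destruct ceq_dec; ring.
Qed.

(** * Homotopy equivalences from carriers *)

Definition carrier K L (Cr : list X -> complex X) : Prop :=
  (forall s, K s -> down_closed (Cr s) /\ fin_contractible (Cr s) /\
     forall s', Cr s s' -> L s') /\
  (forall s s', K s -> K s' -> incl s s' -> forall s0, Cr s s0 -> Cr s' s0).

Lemma carried_ends K Cr (f0 f1 : (X -> R) -> X -> R) I v :
  carried (fun u => u = v) K Cr (fun _ => f0) -> carried (fun u => u = v) K Cr (fun _ => f1) ->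
  carried (fun u => I u /\ ends u) K Cr (fun u => if Req_EM_T u 0 then f0 else f1).
Proof.
  intros H0 H1 s Hs. destruct (H0 s Hs) as [Hc0 [M0 HM0]]. destruct (H1 s Hs) as [Hc1 [M1 HM1]].
  split.
  - intros u t [[_ Hu] Ht] eps Heps.
    destruct (Hc0 v t (conj eq_refl Ht) eps Heps) as (e0 & He0 & Hn0).
    destruct (Hc1 v t (conj eq_refl Ht) eps Heps) as (e1 & He1 & Hn1).
    assert (Hv : forall e, 0 < e -> Rabs (v - v) < e) by (intros; rewrite Rminus_diag, Rabs_R0; auto).
    (* The bound 1 separates the two ends, so [f0] and [f1] never have to be compared. *)
    exists (Rmin 1 (Rmin e0 e1)). split; [repeat apply Rmin_pos; auto; lra|].
    intros u' t' [[_ Hu'] Ht'] Hd Hcl.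
    pose proof (Rmin_l 1 (Rmin e0 e1)). pose proof (Rmin_r 1 (Rmin e0 e1)).
    pose proof (Rmin_l e0 e1). pose proof (Rmin_r e0 e1).
    assert (E : u' = u).
    { apply Rabs_def2 in Hd. destruct Hu as [->| ->], Hu' as [->| ->]; lra. }
    subst u'. destruct Req_EM_T.
    + apply (Hn0 v t'); auto. apply close_mono with (2 := Hcl); lra.
    + apply (Hn1 v t'); auto. apply close_mono with (2 := Hcl); lra.
  - exists (M0 ++ M1). intros u t _ Ht. destruct Req_EM_T.
    + apply lands_mono with (Cr s) M0; auto; [apply incl_appl, incl_refl|]. apply (HM0 v); auto.
    + apply lands_mono with (Cr s) M1; auto; [apply incl_appr, incl_refl|]. apply (HM1 v); auto.
Qed.

(* Maps are obtained as homotopies over the degenerate interval {1/2}, which has no ends. *)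
Lemma carrier_map K L Cr v : down_closed K -> carrier K L Cr -> v = 1 / 2 ->
  exists f, carried (fun u => u = v) K Cr (fun _ => f).
Proof.
  intros HK [H1 H2] ->.
  assert (Hc : forall s, K s -> fin_contractible (Cr s)) by (intros s Hs; apply H1; auto).
  destruct (carrier_extension K Cr (fun u => u = 1 / 2) (fun _ t => t)) as (H & HH & _); auto.
  - intros u ->; lra.
  - intros u m -> _ _ _ Hm. field; lra.
  - intros s Hs. assert (Hno : forall u, ~ (u = 1 / 2 /\ ends u)).
    { intros u [-> [E|E]]; lra. }
    split.
    + intros u t [Hu _]. destruct (Hno u Hu).
    + exists []. intros u t Hu. destruct (Hno u Hu).
  - exists (H (1 / 2)). intros s Hs. destruct (HH s Hs) as [Hcont [M HM]]. split.
    + apply cont2_sub with (1 := Hcont); auto. intros u t [-> _]; auto.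
    + exists M. intros u t -> Ht. apply HM; auto.
Qed.

Lemma carrier_homotopic K L Cr v f0 f1 : down_closed K -> down_closed L -> carrier K L Cr ->
  carried (fun u => u = v) K Cr (fun _ => f0) -> carried (fun u => u = v) K Cr (fun _ => f1) ->
  homotopic X K L f0 f1.
Proof.
  intros HK HL [H1 H2] Hf0 Hf1.
  assert (Hc : forall s, K s -> fin_contractible (Cr s)) by (intros s Hs; apply H1; auto).
  destruct (carrier_extension K Cr (fun u => 0 <= u <= 1)
    (fun u => if Req_EM_T u 0 then f0 else f1)) as (H & HH & HE); auto.
  - intros u m Hu Hm Hm1 Hm2 Hm3. split; [apply Rdiv_le_0_compat; lra|].
    apply Rle_div_l; lra.
  - apply carried_ends with v; auto.
  - assert (HHL : carried (fun u => 0 <= u <= 1) K (fun _ => L) H).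
    { apply carried_mono with (2 := HH). intros s s' Hs; apply H1; auto. }
    exists H. split; [|split].
    + apply carried_hcont; auto.
    + intros u t Hu Ht. apply carried_real with (1 := HHL); auto.
    + intros t Ht. split.
      * rewrite HE; auto; [|lra|left; auto]. destruct Req_EM_T; auto; lra.
      * rewrite HE; auto; [|lra|right; auto]. destruct Req_EM_T; auto; lra.
Qed.

Lemma carried_id K Cr v : (forall s, K s -> Cr s s) ->
  carried (fun u => u = v) K Cr (fun _ t => t).
Proof.
  intros H s Hs. split.
  - intros u t _ eps Heps. exists eps; auto.
  - exists s. intros u t _ Ht. exists s. split; [|split]; auto. apply incl_refl.
Qed.

(** [CLK] produces the inverse [g]. Restricted to [K] it is carried by [CKK], and viewed in [L] by
    [CLL]; both carry the identity as well, and two maps with a common carrier are homotopic. *)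
Lemma incl_he_of_carriers K L CLK CKK CLL : down_closed K -> down_closed L ->
  (forall s, K s -> L s) ->
  carrier L K CLK -> carrier K K CKK -> carrier L L CLL ->
  (forall s s', K s -> CLK s s' -> CKK s s') -> (forall s s', L s -> CLK s s' -> CLL s s') ->
  (forall s, K s -> CKK s s) -> (forall s, L s -> CLL s s) ->
  incl_he X K L.
Proof.
  intros HK HL HKL HLK HKK HLL HK1 HL1 HK2 HL2. split; auto.
  destruct (carrier_map L K CLK (1 / 2) HL HLK eq_refl) as [g Hg].
  assert (HgK : carried (fun u => u = 1 / 2) L (fun _ => K) (fun _ => g)).
  { apply carried_mono with (2 := Hg). intros s s' Hs. apply HLK; auto. }
  split; [|split].
  - intros t (s & Hs & Ht). exists s; auto.
  - intros U HU s t Hs Ht HUt. apply HU; auto.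
  - exists g. split; [|split; [|split]].
    + intros t Ht. apply (carried_real _ _ _ _ (1 / 2) t HgK); auto.
    + apply (carried_wcont L K (fun _ => g) (1 / 2)); auto.
    + apply carrier_homotopic with CKK (1 / 2); auto.
      * intros s Hs. destruct (Hg s (HKL s Hs)) as [Hc [M HM]]. split; auto.
        exists M. intros u t Hu Ht. apply lands_mono with (CLK s) M; eauto. apply incl_refl.
      * apply carried_id; auto.
    + apply carrier_homotopic with CLL (1 / 2); auto.
      * apply carried_mono with (2 := Hg); auto.
      * apply carried_id; auto.
Qed.

End Flow.

(** * Hulls and combings *)

Section Combing.
Context {X : Type}.
Variables (d : X -> X -> R) (r : R).
Hypothesis Hd : is_metric X d.
Hypothesis Hr : 0 < r.

Lemma metric_ge0 x y : 0 <= d x y.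
Proof. apply Hd. Qed.

Lemma metric_xx x : d x x = 0.
Proof. apply Hd; auto. Qed.

Lemma metric_sym x y : d x y = d y x.
Proof. apply Hd. Qed.

Lemma metric_tri x y z : d x z <= d x y + d y z.
Proof. apply Hd. Qed.

Definition combing (g : X -> X -> R -> X) : Prop :=
  (forall p x, g p x 0 = x /\ g p x 1 = p) /\
  (forall p x a b, 0 <= a <= 1 -> 0 <= b <= 1 -> d (g p x a) (g p x b) <= Rabs (a - b) * d p x) /\
  (forall z p x a, 0 <= a <= 1 -> d p z < r -> d x z < r -> d (g p x a) z < r) /\
  (forall z p x y a, 0 <= a <= 1 -> d p z < r -> d x z < r -> d y z < r ->
     d (g p x a) (g p y a) <= d x y).

Definition hull (S : X -> Prop) (y : X) : Prop :=
  forall z, (forall a, S a -> d a z < r) -> d y z < r.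

Lemma hull_sub (S : X -> Prop) x : S x -> hull S x.
Proof. intros H z Hz; auto. Qed.

Lemma hull_mono (S S' : X -> Prop) x : (forall y, S y -> S' y) -> hull S x -> hull S' x.
Proof. intros H Hx z Hz; auto. Qed.

Definition FullIn (Y : X -> Prop) : complex X := fun s => s <> [] /\ forall a, In a s -> Y a.

Definition RipsIn (Y : X -> Prop) : complex X :=
  fun s => Rips X d r s /\ forall a, In a s -> Y a.

(** The centre is required in [Y] too, because the contraction carries it along with the simplex. *)
Definition CechIn (Y : X -> Prop) : complex X :=
  fun s => s <> [] /\ (forall a, In a s -> Y a) /\ exists z, Y z /\ forall a, In a s -> d a z < r / 2.

Lemma Rips_down_closed : down_closed (Rips X d r).
Proof. intros s s' [H1 H2] H3 H4. split; auto. Qed.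

Lemma Cech_down_closed rho : down_closed (Cech X d rho).
Proof. intros s s' [H1 (z & Hz)] H3 H4. split; auto. exists z; auto. Qed.

Lemma FullIn_down_closed Y : down_closed (FullIn Y).
Proof. intros s s' [H1 H2] H3 H4. split; auto. Qed.

Lemma RipsIn_down_closed Y : down_closed (RipsIn Y).
Proof. intros s s' [H1 H2] H3 H4. split; auto. apply Rips_down_closed with s; auto. Qed.

Lemma CechIn_down_closed Y : down_closed (CechIn Y).
Proof. intros s s' (H1 & H2 & z & H3) H4 H5. split; [|split]; auto. exists z; firstorder. Qed.

Section Hull.
Variables (g : X -> X -> R -> X) (S : X -> Prop) (z0 p : X).
Hypothesis Hg : combing g.
Hypothesis Hz0 : forall a, S a -> d a z0 < r.
Hypothesis Hp : S p.

Let Y := hull S.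

(** Each ball containing [S] contains [p] and [x], hence the whole path between them. *)
Lemma hull_combing x a : Y x -> 0 <= a <= 1 -> Y (g p x a).
Proof.
  intros Hx Ha z Hz. apply Hg; auto.
Qed.

Lemma hull_combing_le x y a : Y x -> Y y -> 0 <= a <= 1 -> d (g p x a) (g p y a) <= d x y.
Proof. intros Hx Hy Ha. destruct Hg as (_ & _ & _ & H). apply H with z0; auto. Qed.

(** The factor [2 * r] bounds [d p x], as both points lie in the ball about [z0]. *)
Lemma hull_combing_drift x a b : Y x -> 0 <= a <= 1 -> 0 <= b <= 1 ->
  d (g p x a) (g p x b) <= Rabs (a - b) * (2 * r).
Proof.
  intros Hx Ha Hb. destruct Hg as (_ & H & _).
  eapply Rle_trans; [apply H; auto|]. apply Rmult_le_compat_l; [apply Rabs_pos|].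
  pose proof (metric_tri p z0 x) as Ht. pose proof (Hz0 p Hp). pose proof (Hx z0 Hz0).
  rewrite (metric_sym x z0) in *. lra.
Qed.

Lemma hull_combing_gap x y a b eps : Y x -> Y y -> 0 <= a <= 1 -> 0 <= b <= 1 ->
  0 < eps -> Rabs (a - b) < eps / (2 * r) -> d (g p x a) (g p y b) < d x y + eps.
Proof.
  intros Hx Hy Ha Hb He Hab. pose proof (hull_combing_le x y a Hx Hy Ha).
  pose proof (hull_combing_drift y a b Hy Ha Hb).
  pose proof (metric_tri (g p x a) (g p y a) (g p y b)).
  assert (Rabs (a - b) * (2 * r) < eps); [|lra].
  apply Rlt_div_r in Hab; lra.
Qed.

Lemma gap_pos eps : 0 < eps -> 0 < eps / (2 * r).
Proof. intros H. apply Rdiv_lt_0_compat; lra. Qed.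

Lemma in_combed x s a b : In x (map (fun y => g p y a) s ++ map (fun y => g p y b) s) ->
  exists y, In y s /\ (x = g p y a \/ x = g p y b).
Proof.
  intros H. apply in_app_or in H. destruct H as [H|H];
    apply in_map_iff in H as (y & <- & Hy); exists y; auto.
Qed.

Lemma combed_nonempty s a b : s <> [] ->
  map (fun y => g p y a) s ++ map (fun y => g p y b) s <> [].
Proof. destruct s; simpl; easy. Qed.

Lemma FullIn_contractible : fin_contractible (FullIn Y).
Proof.
  apply (fin_contractible_of_flow _ (fun a x => g p x a) p).
  - apply FullIn_down_closed.
  - split; [easy|]. intros a [<-|[]]. apply hull_sub; auto.
  - intros x _. apply Hg.
  - intros s [Hs HY]. exists 1; split; [lra|]. intros a b Ha Hb _. split.
    + apply combed_nonempty; auto.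
    + intros x Hx. apply in_combed in Hx as (y & Hy & [->| ->]); apply hull_combing; auto.
Qed.

Lemma RipsIn_contractible : fin_contractible (RipsIn Y).
Proof.
  apply (fin_contractible_of_flow _ (fun a x => g p x a) p).
  - apply RipsIn_down_closed.
  - split; [split; [easy|]|].
    + intros a b [<-|[]] [<-|[]]. rewrite metric_xx; auto.
    + intros a [<-|[]]. apply hull_sub; auto.
  - intros x _. apply Hg.
  - intros s [[Hs Hd'] HY].
    (* [eps] is the slack below [r] common to all pairs of vertices; it pays for comparing different
       times. *)
    destruct (fin_eps (list_prod s s) (fun q e => d (fst q) (snd q) + e <= r))
      as (eps & Heps & H).
    { intros; lra. }
    { intros [x y] Hxy. apply in_prod_iff in Hxy as [Hx Hy]. exists (r - d x y); simpl.
      specialize (Hd' x y Hx Hy). split; lra. }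
    exists (eps / (2 * r)). split; [apply gap_pos; auto|].
    assert (Hgap : forall x y a b, In x s -> In y s -> 0 <= a <= 1 -> 0 <= b <= 1 ->
      Rabs (a - b) < eps / (2 * r) -> d (g p x a) (g p y b) < r).
    { intros x y a b Hx Hy Ha Hb Hab. specialize (H (x, y) (in_prod _ _ _ _ Hx Hy)).
      simpl in H. pose proof (hull_combing_gap x y a b eps (HY x Hx) (HY y Hy) Ha Hb Heps Hab). lra. }
    intros a b Ha Hb Hab. split; [split|].
    + apply combed_nonempty; auto.
    + assert (H0 : forall c, Rabs (c - c) < eps / (2 * r)).
      { intros c. rewrite Rminus_diag, Rabs_R0. apply gap_pos; auto. }
      intros x y Hx Hy. apply in_combed in Hx as (x' & Hx & [->| ->]);
        apply in_combed in Hy as (y' & Hy & [->| ->]); apply Hgap; auto.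
      rewrite Rabs_minus_sym; auto.
    + intros x Hx. apply in_combed in Hx as (y & Hy & [->| ->]); apply hull_combing; auto.
Qed.

Lemma CechIn_contractible : fin_contractible (CechIn Y).
Proof.
  apply (fin_contractible_of_flow _ (fun a x => g p x a) p).
  - apply CechIn_down_closed.
  - split; [easy|split].
    + intros a [<-|[]]. apply hull_sub; auto.
    + exists p. split; [apply hull_sub; auto|]. intros a [<-|[]]. rewrite metric_xx; lra.
  - intros x _. apply Hg.
  - intros s (Hs & HY & z & Hz & Hsz).
    destruct (fin_eps s (fun x e => d x z + e <= r / 2)) as (eps & Heps & H).
    { intros; lra. }
    { intros x Hx. exists (r / 2 - d x z); simpl. specialize (Hsz x Hx). split; lra. }
    exists (eps / (2 * r)). split; [apply gap_pos; auto|].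
    intros a b Ha Hb Hab. split; [|split].
    + apply combed_nonempty; auto.
    + intros x Hx. apply in_combed in Hx as (y & Hy & [->| ->]); apply hull_combing; auto.
    (* The centre at time [a] also serves the vertices at time [b], within the slack [eps]. *)
    + exists (g p z a). split; [apply hull_combing; auto|].
      intros x Hx. apply in_combed in Hx as (y & Hy & [->| ->]); specialize (H y Hy).
      * pose proof (hull_combing_le y z a (HY y Hy) Hz Ha). lra.
      * rewrite Rabs_minus_sym in Hab.
        pose proof (hull_combing_gap y z b a eps (HY y Hy) Hz Hb Ha Heps Hab). lra.
Qed.

End Hull.

(** * Carriers between the Cech and Rips complexes *)

Variable g : X -> X -> R -> X.
Hypothesis Hg : combing g.

Definition vertices (s : list X) : X -> Prop := fun x => In x s.

(* Contains every centre of s as a simplex of Cech X d (r / 2). *)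
Definition thick (s : list X) : X -> Prop := fun x => exists a, In a s /\ d a x < r / 2.

Lemma nonempty_In (s : list X) : s <> [] -> exists a, In a s.
Proof. destruct s as [|a s]; [easy|]. exists a; simpl; auto. Qed.

Lemma Rips_bounded s : Rips X d r s -> exists z p, (forall a, In a s -> d a z < r) /\ In p s.
Proof. intros [Hs H]. destruct (nonempty_In s Hs) as [a Ha]. exists a, a. auto. Qed.

Lemma Cech_bounded s : Cech X d r s -> exists z p, (forall a, In a s -> d a z < r) /\ In p s.
Proof. intros [Hs [z Hz]]. destruct (nonempty_In s Hs) as [a Ha]. exists z, a. auto. Qed.

Lemma thick_bounded s : Cech X d (r / 2) s ->
  exists z p, (forall a, thick s a -> d a z < r) /\ thick s p.
Proof.
  intros [Hs [z Hz]]. destruct (nonempty_In s Hs) as [a Ha]. exists z, a. split.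
  - intros x (b & Hb & Hx). specialize (Hz b Hb). pose proof (metric_tri x b z) as Ht.
    rewrite (metric_sym x b) in Ht. lra.
  - exists a. rewrite metric_xx. split; auto; lra.
Qed.

Lemma Cech_Rips s : Cech X d (r / 2) s -> Rips X d r s.
Proof.
  intros [Hs [z Hz]]. split; auto. intros a b Ha Hb.
  pose proof (Hz a Ha). pose proof (Hz b Hb). pose proof (metric_tri a z b) as Ht.
  rewrite (metric_sym z b) in Ht. lra.
Qed.

Lemma Rips_Cech s : Rips X d r s -> Cech X d r s.
Proof.
  intros [Hs H]. split; auto. destruct (nonempty_In s Hs) as [a Ha]. exists a; auto.
Qed.

Lemma CechIn_Cech Y s : CechIn Y s -> Cech X d (r / 2) s.
Proof. intros (H & _ & z & _ & Hz). split; auto. exists z; auto. Qed.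

Lemma CechIn_RipsIn Y s : CechIn Y s -> RipsIn Y s.
Proof. intros H. split; [apply Cech_Rips, CechIn_Cech with Y; auto|apply H]. Qed.

Lemma FullIn_mono Y Y' s : (forall x, Y x -> Y' x) -> FullIn Y s -> FullIn Y' s.
Proof. intros H (H1 & H2). split; auto. Qed.

Lemma RipsIn_mono Y Y' s : (forall x, Y x -> Y' x) -> RipsIn Y s -> RipsIn Y' s.
Proof. intros H (H1 & H2). split; auto. Qed.

Lemma CechIn_mono Y Y' s : (forall x, Y x -> Y' x) -> CechIn Y s -> CechIn Y' s.
Proof. intros H (H1 & H2 & z & H3 & H4). split; [|split]; auto. exists z; auto. Qed.

Lemma hull_vertices_mono s s' x : incl s s' -> hull (vertices s) x -> hull (vertices s') x.
Proof. intros H. apply hull_mono. intros y; apply H. Qed.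

Lemma hull_thick_mono s s' x : incl s s' -> hull (thick s) x -> hull (thick s') x.
Proof. intros H. apply hull_mono. intros y (a & Ha & Hy). exists a; auto. Qed.

Lemma hull_vertices_thick s x : hull (vertices s) x -> hull (thick s) x.
Proof. apply hull_mono. intros y Hy. exists y. rewrite metric_xx. split; auto; lra. Qed.

Lemma carrier_Cech_In (K : complex X) :
  (forall s, K s -> exists z p, (forall a, In a s -> d a z < r) /\ In p s) ->
  carrier K (Cech X d (r / 2)) (fun s => CechIn (hull (vertices s))).
Proof.
  intros HK. split.
  - intros s Hs. destruct (HK s Hs) as (z & p & Hz & Hp). split; [|split].
    + apply CechIn_down_closed.
    + apply (CechIn_contractible g (vertices s) z p); auto.
    + apply CechIn_Cech.
  - intros s s' _ _ Hi s0. apply CechIn_mono. intros x; apply hull_vertices_mono; auto.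
Qed.

Lemma carrier_Cech_thick :
  carrier (Cech X d (r / 2)) (Cech X d (r / 2)) (fun s => CechIn (hull (thick s))).
Proof.
  split.
  - intros s Hs. destruct (thick_bounded s Hs) as (z & p & Hz & Hp). split; [|split].
    + apply CechIn_down_closed.
    + apply (CechIn_contractible g (thick s) z p); auto.
    + apply CechIn_Cech.
  - intros s s' _ _ Hi s0. apply CechIn_mono. intros x; apply hull_thick_mono; auto.
Qed.

Lemma carrier_Rips_In (K : complex X) :
  (forall s, K s -> exists z p, (forall a, In a s -> d a z < r) /\ In p s) ->
  carrier K (Rips X d r) (fun s => RipsIn (hull (vertices s))).
Proof.
  intros HK. split.
  - intros s Hs. destruct (HK s Hs) as (z & p & Hz & Hp). split; [|split].
    + apply RipsIn_down_closed.
    + apply (RipsIn_contractible g (vertices s) z p); auto.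
    + intros s' H; apply H.
  - intros s s' _ _ Hi s0. apply RipsIn_mono. intros x; apply hull_vertices_mono; auto.
Qed.

(** A ball containing [s] contains its hull, so a centre of [s] is a centre of every finite subset
    of the hull. *)
Lemma carrier_full :
  carrier (Cech X d r) (Cech X d r) (fun s => FullIn (hull (vertices s))).
Proof.
  split.
  - intros s Hs. destruct (Cech_bounded s Hs) as (z & p & Hz & Hp). split; [|split].
    + apply FullIn_down_closed.
    + apply (FullIn_contractible g (vertices s) p); auto.
    + intros s' [H1 H2]. split; auto. exists z. intros a Ha. apply (H2 a Ha); auto.
  - intros s s' _ _ Hi s0. apply FullIn_mono. intros x; apply hull_vertices_mono; auto.
Qed.

Lemma incl_he_of_combing :
  incl_he X (Cech X d (r / 2)) (Rips X d r) /\ incl_he X (Rips X d r) (Cech X d r).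
Proof.
  split.
  (* Only the second carrier has to contain each Cech simplex together with a centre, hence [thick]
     there; a Rips simplex need not have a centre of radius [r / 2]. *)
  - apply incl_he_of_carriers with (fun s => CechIn (hull (vertices s)))
      (fun s => CechIn (hull (thick s))) (fun s => RipsIn (hull (vertices s))).
    + apply Cech_down_closed.
    + apply Rips_down_closed.
    + apply Cech_Rips.
    + apply carrier_Cech_In, Rips_bounded.
    + apply carrier_Cech_thick.
    + apply carrier_Rips_In, Rips_bounded.
    + intros s s' _. apply CechIn_mono, hull_vertices_thick.
    + intros s s' _. apply CechIn_RipsIn.
    + intros s [Hs [z Hz]]. split; [|split]; auto.
      * intros a Ha. apply hull_sub. exists a. rewrite metric_xx. split; auto; lra.
      * exists z. split; auto. destruct (nonempty_In s Hs) as [a Ha].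
        apply hull_sub. exists a; auto.
    + intros s Hs. split; auto. intros a Ha. apply hull_sub; auto.
  (* Vertices of a Cech simplex of radius [r] may be almost [2 * r] apart, but they share an
     [r]-ball, which is all that contracting the Rips part of their hull requires. *)
  - apply incl_he_of_carriers with (fun s => RipsIn (hull (vertices s)))
      (fun s => RipsIn (hull (vertices s))) (fun s => FullIn (hull (vertices s))).
    + apply Rips_down_closed.
    + apply Cech_down_closed.
    + apply Rips_Cech.
    + apply carrier_Rips_In, Cech_bounded.
    + apply carrier_Rips_In, Rips_bounded.
    + apply carrier_full.
    + auto.
    + intros s s' _ [H1 H2]. split; auto. apply H1.
    + intros s Hs. split; auto. intros a Ha. apply hull_sub; auto.
    + intros s [Hs _]. split; auto. intros a Ha. apply hull_sub; auto.
Qed.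

End Combing.

(** * Combings from geodesics *)

Section Geodesics.
Context {X : Type}.
Variables (d : X -> X -> R) (r : R).
Hypothesis Hd : is_metric X d.
Hypothesis Hr : 0 < r.

Lemma geod_dist_left x y g t : geod_from_to X d g x y -> 0 <= t <= d x y -> d x (g t) = t.
Proof.
  intros (H & H0 & H1) Ht. rewrite <- H0 at 1. rewrite H by lra.
  rewrite Rabs_minus_sym, Rminus_0_r. apply Rabs_pos_eq; lra.
Qed.

Lemma geod_dist_right x y g t : geod_from_to X d g x y -> 0 <= t <= d x y -> d (g t) y = d x y - t.
Proof.
  intros (H & H0 & H1) Ht. rewrite <- H1 at 1. rewrite H by lra.
  rewrite Rabs_minus_sym. apply Rabs_pos_eq; lra.
Qed.

Lemma geod_rev x y g : geod_from_to X d g x y -> geod_from_to X d (fun t => g (d x y - t)) y x.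
Proof.
  intros (H & H0 & H1).
  split; [|split].
  - intros s t Hs Ht. rewrite (metric_sym d Hd y x) in Hs, Ht. rewrite H by lra.
    rewrite <- Rabs_Ropp. f_equal; ring.
  - rewrite Rminus_0_r; auto.
  - rewrite (metric_sym d Hd y x), Rminus_diag; auto.
Qed.

(** Any choice of geodesics will do, since both hypotheses concern all of them. Time is reversed
    because [G p x] starts at [p], where the combing has to end. *)
Lemma combing_of_geodesics : geodesic_space X d ->
  (forall x y z g t, geod_from_to X d g x y -> d x z < r -> d y z < r -> 0 <= t <= d x y ->
     d (g t) z < r) ->
  (forall p x y z g g' t, geod_from_to X d g p x -> geod_from_to X d g' p y ->
     d p z < r -> d x z < r -> d y z < r -> 0 <= t <= 1 ->
     d (g (t * d p x)) (g' (t * d p y)) <= d x y) ->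
  exists g, combing d r g.
Proof.
  intros Hgeo Hconv Hcontr.
  pose (G := fun p x => proj1_sig (constructive_indefinite_description _ (Hgeo p x))).
  assert (HG : forall p x, geod_from_to X d (G p x) p x).
  { intros p x. unfold G. apply proj2_sig. }
  assert (Ht : forall p x a, 0 <= a <= 1 -> 0 <= (1 - a) * d p x <= d p x).
  { intros p x a Ha. pose proof (metric_ge0 d Hd p x). split; nra. }
  exists (fun p x a => G p x ((1 - a) * d p x)). split; [|split; [|split]].
  - intros p x. rewrite Rminus_0_r, Rmult_1_l, Rminus_diag, Rmult_0_l. apply and_comm. apply HG.
  - intros p x a b Ha Hb. destruct (HG p x) as [H _]. rewrite H by (apply Ht; auto).
    replace ((1 - a) * d p x - (1 - b) * d p x) with (- ((a - b) * d p x)) by ring.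
    rewrite Rabs_Ropp, Rabs_mult, (Rabs_pos_eq (d p x)); [lra|]. apply metric_ge0; auto.
  - intros z p x a Ha Hp Hx. apply (Hconv p x); auto.
  - intros z p x y a Ha Hp Hx Hy. apply (Hcontr p x y z); auto. lra.
Qed.

(** * Geodesic spaces with r(X) > 0 *)

Lemma rX_cond_above c : Rbar_le (Finite (2 * r)) (rX X d) -> c < 2 * r ->
  exists rho, c < rho /\ rX_cond X d rho.
Proof.
  intros H Hc. apply NNPP. intros Hn.
  destruct (Lub_Rbar_correct (rX_cond X d)) as [_ Hlub].
  specialize (Hlub (Finite c)).
  assert (Hub : Rbar_le (rX X d) (Finite c)).
  { apply Hlub. intros rho Hrho. simpl. apply Rnot_lt_le. intros Hl. apply Hn.
    exists rho; auto. }
  pose proof (Rbar_le_trans _ _ _ H Hub) as Hle. simpl in Hle. lra.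
Qed.

Lemma combing_of_rX : geodesic_space X d -> Rbar_le (Finite (2 * r)) (rX X d) ->
  exists g, combing d r g.
Proof.
  intros Hgeo HrX. apply combing_of_geodesics; auto.
  - intros x y z g t Hg Hx Hy Ht.
    assert (Hxy : d x y < 2 * r).
    { pose proof (metric_tri d Hd x z y) as H. rewrite (metric_sym d Hd z y) in H. lra. }
    destruct (rX_cond_above (Rmax (d x y) r) HrX) as (rho & Hrho & _ & H & _).
    { apply Rmax_lub_lt; lra. }
    apply Rmax_Rlt in Hrho. rewrite (metric_sym d Hd).
    rewrite (metric_sym d Hd) in Hx. rewrite (metric_sym d Hd) in Hy.
    eapply Rle_lt_trans; [apply (H x y z g t); auto; lra|]. apply Rmax_lub_lt; auto.
  - intros p x y z g g' t Hg Hg' Hp Hx Hy Ht.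
    assert (Hpx : d p x < 2 * r).
    { pose proof (metric_tri d Hd p z x) as H. rewrite (metric_sym d Hd z x) in H. lra. }
    assert (Hpy : d p y < 2 * r).
    { pose proof (metric_tri d Hd p z y) as H. rewrite (metric_sym d Hd z y) in H. lra. }
    destruct (rX_cond_above (Rmax (d p x) (d p y)) HrX) as (rho & Hrho & _ & _ & H).
    { apply Rmax_lub_lt; lra. }
    apply Rmax_Rlt in Hrho. pose proof (metric_ge0 d Hd p x). pose proof (metric_ge0 d Hd p y).
    destruct Hg as (Hg & Hg0 & Hg1), Hg' as (Hg' & Hg0' & Hg1').
    (* Condition (3) excludes [t = 1], where the claim is an equality. *)
    destruct (Rlt_dec t 1) as [Ht1|Ht1].
    + rewrite <- Hg1 at 2. rewrite <- Hg1' at 2. apply H; auto; try lra. congruence.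
    + replace t with 1 by lra. rewrite !Rmult_1_l, Hg1, Hg1'. lra.
Qed.

(** * Thin triangles and the four-point condition *)

Definition thin_triangles (c : R) : Prop :=
  forall x y z gxy gyz gzx t, d x y + d y z + d z x < c ->
    geod_from_to X d gxy x y -> geod_from_to X d gyz y z -> geod_from_to X d gzx z x ->
    0 <= t <= d x y ->
    (exists s, 0 <= s <= d y z /\ gyz s = gxy t) \/ (exists s, 0 <= s <= d z x /\ gzx s = gxy t).

Section Thin.
Hypothesis Hgeo : geodesic_space X d.
Hypothesis Hthin : thin_triangles (4 * r).

(** The side from [x] to [y] is at most the sum of the two others, each below [r]. *)
Lemma ball_perimeter x y z : d x z < r -> d y z < r -> d x y + d y z + d z x < 4 * r.
Proof.
  intros Hx Hy. pose proof (metric_tri d Hd x z y). rewrite (metric_sym d Hd z y) in *.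
  rewrite (metric_sym d Hd z x). lra.
Qed.

(** By thinness [g t] lies on a side ending at [z], and these sides are shorter than [r]. *)
Lemma thin_convex x y z g t : geod_from_to X d g x y -> d x z < r -> d y z < r ->
  0 <= t <= d x y -> d (g t) z < r.
Proof.
  intros Hg Hx Hy Ht. destruct (Hgeo y z) as [g1 Hg1], (Hgeo z x) as [g2 Hg2].
  destruct (Hthin x y z g g1 g2 t) as [(s & Hs & <-)|(s & Hs & <-)]; auto.
  - apply ball_perimeter; auto.
  - rewrite (geod_dist_right y z); auto. lra.
  - rewrite (metric_sym d Hd), (geod_dist_left z x); auto. rewrite (metric_sym d Hd z x) in Hs. lra.
Qed.

(* Geodesics from z to x and y agree up to the Gromov product (x|y)_z. *)
Lemma thin_agree x y z gx gy s : d x z < r -> d y z < r ->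
  geod_from_to X d gx z x -> geod_from_to X d gy z y ->
  0 <= s -> 2 * s < d z x + d z y - d x y -> gx s = gy s.
Proof.
  intros Hx Hy Hgx Hgy Hs Hs2. destruct (Hgeo x y) as [g Hg].
  pose proof (metric_tri d Hd z x y). pose proof (metric_tri d Hd z y x).
  rewrite (metric_sym d Hd y x) in *.
  destruct (Hthin z x y gx g (fun t => gy (d z y - t)) s) as [(s' & Hs' & E)|(s' & Hs' & E)];
    auto; try lra.
  - pose proof (ball_perimeter x y z Hx Hy). rewrite (metric_sym d Hd y z) in *. lra.
  - apply geod_rev; auto.
  (* Were [gx s] on the side from [x] to [y], going from [z] to [y] through it would give
     [2 * s >= d z x + d z y - d x y]. *)
  - exfalso. pose proof (geod_dist_left x y g s' Hg Hs') as E1.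
    pose proof (geod_dist_right x y g s' Hg Hs') as E2.
    assert (Hsl : 0 <= s <= d z x) by lra.
    pose proof (geod_dist_left z x gx s Hgx Hsl) as E3.
    pose proof (geod_dist_right z x gx s Hgx Hsl) as E4.
    rewrite E in E1, E2. rewrite (metric_sym d Hd (gx s) x) in E4.
    pose proof (metric_tri d Hd z (gx s) y). lra.
  - rewrite <- E. f_equal. rewrite (metric_sym d Hd y z) in Hs'.
    assert (Hsl : 0 <= s <= d z x) by lra.
    pose proof (geod_dist_left z x gx s Hgx Hsl) as E3. rewrite <- E in E3.
    rewrite (geod_dist_left z y gy) in E3; auto; lra.
Qed.

(** The ultrametric inequality for doubled Gromov products at [z]. If it fails, the geodesics to [x]
    and [y] both agree with the one to [w] at some [s] with [2 * s] beyond the doubled product of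
    [x] and [y]; but a common point at distance [s] gives [d x y <= d z x + d z y - 2 * s]. *)
Lemma thin_ultrametric x y w z : d x z < r -> d y z < r -> d w z < r ->
  d z x + d z y - d x y >= d z x + d z w - d x w \/
  d z x + d z y - d x y >= d z w + d z y - d w y.
Proof.
  intros Hx Hy Hw.
  set (G := d z x + d z y - d x y). set (G1 := d z x + d z w - d x w).
  set (G2 := d z w + d z y - d w y).
  destruct (Rle_dec G1 G) as [|H1]; [lra|]. destruct (Rle_dec G2 G) as [|H2]; [lra|].
  exfalso.
  destruct (Hgeo z x) as [gx Hgx], (Hgeo z y) as [gy Hgy], (Hgeo z w) as [gw Hgw].
  assert (Hs : exists s, G < 2 * s /\ 2 * s < G1 /\ 2 * s < G2).
  (* [2 * s] is the midpoint of [G] and the smaller of [G1] and [G2]. *)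
  { exists ((G + Rmin G1 G2) / 4). pose proof (Rmin_l G1 G2). pose proof (Rmin_r G1 G2).
    assert (G < Rmin G1 G2) by (apply Rmin_glb_lt; lra). lra. }
  destruct Hs as (s & Hs & Hs1 & Hs2). unfold G, G1, G2 in *. clear G G1 G2 H1 H2.
  pose proof (metric_tri d Hd x z y) as T. rewrite (metric_sym d Hd x z) in T.
  pose proof (thin_agree x w z gx gw s Hx Hw Hgx Hgw ltac:(lra) Hs1) as E1.
  pose proof (thin_agree w y z gw gy s Hw Hy Hgw Hgy ltac:(lra) Hs2) as E2.
  pose proof (metric_tri d Hd z x w) as T1. pose proof (metric_tri d Hd z w x) as T2.
  pose proof (metric_tri d Hd z y w) as T3. pose proof (metric_tri d Hd z w y) as T4.
  rewrite (metric_sym d Hd w x) in T2. rewrite (metric_sym d Hd y w) in T3.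
  pose proof (geod_dist_right z x gx s Hgx ltac:(lra)) as E3.
  pose proof (geod_dist_right z y gy s Hgy ltac:(lra)) as E4.
  pose proof (metric_tri d Hd x (gx s) y) as T5. rewrite (metric_sym d Hd x (gx s)) in T5.
  rewrite E1, E2 in T5. rewrite E1, E2 in E3. lra.
Qed.

(** Written with Gromov products at [z], the distances to [z] cancel, and four ultrametric
    inequalities give the claim. *)
Lemma thin_four_point a b c e z : d a z < r -> d b z < r -> d c z < r -> d e z < r ->
  d a b + d c e <= d a c + d b e \/ d a b + d c e <= d a e + d b c.
Proof.
  intros Ha Hb Hc He.
  pose proof (thin_ultrametric a b c z Ha Hb Hc). pose proof (thin_ultrametric a b e z Ha Hb He).
  pose proof (thin_ultrametric c e a z Hc He Ha). pose proof (thin_ultrametric c e b z Hc He Hb).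
  rewrite (metric_sym d Hd c b), (metric_sym d Hd e b), (metric_sym d Hd c a) in *.
  destruct (Rle_dec (d a b + d c e) (d a c + d b e)) as [|H3]; auto. right.
  apply Rnot_lt_le. intros H4. lra.
Qed.

Lemma combing_of_thin : exists g, combing d r g.
Proof.
  apply combing_of_geodesics; auto.
  - intros; eapply thin_convex; eauto.
  - intros p x y z g g' t Hg Hg' Hp Hx Hy Ht.
    pose proof (metric_ge0 d Hd p x). pose proof (metric_ge0 d Hd p y).
    assert (Hta : 0 <= t * d p x <= d p x) by (split; nra).
    assert (Htb : 0 <= t * d p y <= d p y) by (split; nra).
    assert (HP : d (g (t * d p x)) z < r) by (eapply thin_convex; eauto).
    assert (HQ : d (g' (t * d p y)) z < r) by (eapply thin_convex; eauto).
    pose proof (geod_dist_left p x g _ Hg Hta) as E1.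
    pose proof (geod_dist_right p x g _ Hg Hta) as E2.
    pose proof (geod_dist_left p y g' _ Hg' Htb) as E3.
    pose proof (geod_dist_right p y g' _ Hg' Htb) as E4.
    pose proof (metric_tri d Hd p x y) as T1. pose proof (metric_tri d Hd p y x) as T2.
    rewrite (metric_sym d Hd y x) in T2.
    assert (B1 : t * d p x - t * d p y <= d x y) by nra.
    assert (B2 : t * d p y - t * d p x <= d x y) by nra.
    set (P := g (t * d p x)) in *. set (Q := g' (t * d p y)) in *.
    (* [F1] yields [d P y <= d x y + (1 - t) * d p y], using [B2] in one alternative; with it [F2]
       bounds [d P Q], its other alternative being [B1]. *)
    pose proof (thin_four_point P y p x z HP Hy Hp Hx) as F1.
    pose proof (thin_four_point P Q p y z HP HQ Hp Hy) as F2.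
    rewrite (metric_sym d Hd P p), (metric_sym d Hd Q p), (metric_sym d Hd y p), (metric_sym d Hd y x) in *.
    lra.
Qed.

End Thin.
End Geodesics.

(** * Winding numbers *)

Lemma IZR_small n : Rabs (IZR n) < 1 -> IZR n = 0.
Proof.
  intros H. apply Rabs_def2 in H as [H1 H2]. apply lt_IZR in H1.
  assert (-1 < n)%Z by (apply lt_IZR; lra). f_equal. lia.
Qed.

(* The representative of a modulo Z lying in [-1/2, 1/2). *)
Definition centered (a : R) : R := a - IZR (up (a - 1 / 2)).

Lemma centered_congr a : exists n, centered a = a - IZR n.
Proof. eexists; reflexivity. Qed.

Lemma centered_eq a b n : a - b = IZR n -> Rabs b < 1 / 4 -> centered a = b.
Proof.
  intros H Hb. unfold centered. destruct (archimed (a - 1 / 2)) as [H1 H2].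
  apply Rabs_def2 in Hb.
  assert (E : IZR (up (a - 1 / 2) - n) = 0).
  { apply IZR_small. rewrite minus_IZR. apply Rabs_def1; lra. }
  rewrite minus_IZR in E. lra.
Qed.

Lemma centered_small a n : Rabs (a - IZR n) < 1 / 4 -> Rabs (centered a) < 1 / 4.
Proof. intros H. rewrite (centered_eq a (a - IZR n) n); auto; ring. Qed.

(** Both sides are congruent modulo Z, and four terms below 1/4 keep them less than 1 apart. *)
Lemma centered_cycle a b c e : Rabs (centered (b - a)) < 1 / 4 -> Rabs (centered (c - b)) < 1 / 4 ->
  Rabs (centered (e - a)) < 1 / 4 -> Rabs (centered (c - e)) < 1 / 4 ->
  centered (b - a) + centered (c - b) = centered (e - a) + centered (c - e).
Proof.
  destruct (centered_congr (b - a)) as [n1 ->]. destruct (centered_congr (c - b)) as [n2 ->].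
  destruct (centered_congr (e - a)) as [n3 ->]. destruct (centered_congr (c - e)) as [n4 ->].
  intros H1 H2 H3 H4. apply Rabs_def2 in H1, H2, H3, H4.
  assert (E : IZR (n3 + n4 - n1 - n2) = 0).
  { apply IZR_small. rewrite !minus_IZR, plus_IZR. apply Rabs_def1; lra. }
  rewrite !minus_IZR, plus_IZR in E. lra.
Qed.

Section Winding.
Context {X : Type}.
Variable d : X -> X -> R.

(* q is continuous as a map to R/Z. *)
Definition circle_cont (q : X -> R) : Prop :=
  forall x eps, 0 < eps -> exists del, 0 < del /\
    forall y, d y x < del -> exists n, Rabs (q y - q x - IZR n) < eps.

Variables (q : X -> R) (H : R -> R -> X) (f : R -> R).
Hypothesis Hq : circle_cont q.
Hypothesis HH : cont_sq X d H.
Hypothesis Hper : forall u, 0 <= u <= 1 -> H u 0 = H u 1.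
Hypothesis Hf : continuity f.
Hypothesis Hlift : forall s, 0 <= s <= 1 -> exists n, f s - q (H 0 s) = IZR n.
Hypothesis Hconst : exists c, forall s, 0 <= s <= 1 -> H 1 s = c.

(** Uniform continuity modulo Z by a Lebesgue number. Oscillation below 1/8 about the centre on
    squares of radius [2 * e] gives 1/4 for any two points closer than a uniform lower bound of the
    [e] used. *)
Lemma winding_grid : exists N, (0 < N)%nat /\ forall u v u' v',
  0 <= u <= 1 -> 0 <= v <= 1 -> 0 <= u' <= 1 -> 0 <= v' <= 1 ->
  Rabs (u' - u) <= / INR N -> Rabs (v' - v) <= / INR N ->
  Rabs (centered (q (H u' v') - q (H u v))) < 1 / 4 /\ Rabs (f v' - f v) < 1 / 4.
Proof.
  assert (Hloc : forall u v, exists e : posreal, 0 <= u <= 1 -> 0 <= v <= 1 ->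
    forall u' v', 0 <= u' <= 1 -> 0 <= v' <= 1 -> Rabs (u' - u) < 2 * e -> Rabs (v' - v) < 2 * e ->
    (exists n, Rabs (q (H u' v') - q (H u v) - IZR n) < 1 / 8) /\ Rabs (f v' - f v) < 1 / 8).
  { intros u v. destruct (classic (0 <= u <= 1 /\ 0 <= v <= 1)) as [[Hu Hv]|Hn].
    - destruct (Hq (H u v) (1 / 8) ltac:(lra)) as (e1 & He1 & H1).
      destruct (HH u v Hu Hv e1 He1) as (e2 & He2 & H2).
      destruct (Hf v (1 / 8) ltac:(lra)) as (e3 & He3 & H3).
      assert (He : 0 < Rmin e2 e3 / 2) by (apply Rdiv_lt_0_compat; [apply Rmin_pos; auto|lra]).
      exists (mkposreal _ He). simpl. intros _ _ u' v' Hu' Hv' Hdu Hdv.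
      pose proof (Rmin_l e2 e3). pose proof (Rmin_r e2 e3). split.
      + apply H1, H2; auto; lra.
      + destruct (Req_dec v' v) as [->|Hne]; [rewrite Rminus_diag, Rabs_R0; lra|].
        apply H3. split; [split; [exact I|auto]|]. simpl. unfold Rdist. lra.
    - exists (mkposreal 1 Rlt_0_1). tauto. }
  pose (del := fun u v => proj1_sig (constructive_indefinite_description _ (Hloc u v))).
  assert (Hdel : forall u v, 0 <= u <= 1 -> 0 <= v <= 1 ->
    forall u' v', 0 <= u' <= 1 -> 0 <= v' <= 1 -> Rabs (u' - u) < 2 * del u v ->
    Rabs (v' - v) < 2 * del u v ->
    (exists n, Rabs (q (H u' v') - q (H u v) - IZR n) < 1 / 8) /\ Rabs (f v' - f v) < 1 / 8).
  { intros u v. unfold del. apply proj2_sig. }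
  clearbody del. destruct (compactness_value_2d 0 1 0 1 del) as [e He].
  destruct (archimed_cor1 e (cond_pos e)) as (N & HN & HN0).
  exists N. split; auto. intros u v u' v' Hu Hv Hu' Hv' Hdu Hdv.
  specialize (He u v Hu Hv). apply NNPP in He as (a & b & Ha & Hb & Hua & Hvb & Hle).
  pose proof (cond_pos (del a b)).
  destruct (Hdel a b Ha Hb u v Hu Hv) as [[n Hn] Hfn]; [lra|lra|].
  destruct (Hdel a b Ha Hb u' v' Hu' Hv') as [[n' Hn'] Hfn'].
  - replace (u' - a) with ((u' - u) + (u - a)) by ring.
    eapply Rle_lt_trans; [apply Rabs_triang|]. lra.
  - replace (v' - b) with ((v' - v) + (v - b)) by ring.
    eapply Rle_lt_trans; [apply Rabs_triang|]. lra.
  - apply Rabs_def2 in Hn, Hfn, Hn', Hfn'. split.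
    + apply centered_small with (n' - n)%Z. rewrite minus_IZR. apply Rabs_def1; lra.
    + apply Rabs_def1; lra.
Qed.

(* Along each row of a fine grid the centered increments of q sum to the winding number,
   which does not change between adjacent rows. *)
Lemma winding_zero : f 0 = f 1.
Proof.
  destruct winding_grid as (N & HN & HG).
  assert (HNR : 0 < INR N) by (apply lt_0_INR; auto).
  set (p := fun i => INR i / INR N).
  assert (Hp : forall i, (i <= N)%nat -> 0 <= p i <= 1).
  { intros i Hi. apply le_INR in Hi. pose proof (pos_INR i). unfold p.
    split; [apply Rdiv_le_0_compat; lra|apply Rle_div_l; lra]. }
  assert (Hinv : 0 < / INR N) by (apply Rinv_0_lt_compat; auto).
  assert (Hps : forall i, Rabs (p (S i) - p i) <= / INR N).
  { intros i. unfold p. rewrite S_INR. replace ((INR i + 1) / INR N - INR i / INR N) with (/ INR N)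
      by (field; lra). rewrite Rabs_pos_eq; lra. }
  assert (Hp0 : forall i, Rabs (p i - p i) <= / INR N).
  { intros i. rewrite Rminus_diag, Rabs_R0. lra. }
  assert (E0 : p 0%nat = 0) by (unfold p; simpl; field; lra).
  assert (EN : p N = 1) by (unfold p; field; lra).
  set (Q := fun i j => q (H (p i) (p j))).
  set (row := fun i => lsum (seq 0 N) (fun j => centered (Q i (S j) - Q i j))).
  assert (Hrow : forall i, (S i <= N)%nat -> row i = row (S i)).
  { intros i Hi.
    (* Adding [centered_cycle] over the first [k] squares leaves the outer vertical increments,
       which coincide for [k = N] because every row is a loop. *)
    assert (Hk : forall k, (k <= N)%nat ->
      lsum (seq 0 k) (fun j => centered (Q i (S j) - Q i j)) + centered (Q (S i) k - Q i k)
      = centered (Q (S i) 0%nat - Q i 0%nat)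
        + lsum (seq 0 k) (fun j => centered (Q (S i) (S j) - Q (S i) j))).
    { induction k as [|k IH]; intros Hk; [simpl; ring|].
      rewrite seq_S, !lsum_app. cbn [lsum fold_right Nat.add].
      specialize (IH ltac:(lia)).
      assert (Hc : centered (Q i (S k) - Q i k) + centered (Q (S i) (S k) - Q i (S k))
        = centered (Q (S i) k - Q i k) + centered (Q (S i) (S k) - Q (S i) k)).
      { apply centered_cycle; apply HG; auto; apply Hp; lia. }
      lra. }
    specialize (Hk N (le_n _)). unfold row.
    assert (EQ : forall i', (i' <= N)%nat -> Q i' N = Q i' 0%nat).
    { intros i' Hi'. unfold Q. rewrite E0, EN, Hper; auto. }
    rewrite (EQ i), (EQ (S i)) in Hk by lia. lra. }
  assert (Hrows : forall i, (i <= N)%nat -> row i = row 0%nat).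
  { induction i as [|i IH]; auto. intros Hi. rewrite <- Hrow by auto. apply IH; lia. }
  assert (HrowN : row N = 0).
  { destruct Hconst as [c Hc]. apply lsum_0. intros j Hj. apply in_seq in Hj.
    unfold Q. rewrite EN, !Hc by (apply Hp; lia).
    apply centered_eq with 0%Z; [ring|]. rewrite Rabs_R0; lra. }
  assert (Htel : forall k, (k <= N)%nat ->
    lsum (seq 0 k) (fun j => centered (Q 0%nat (S j) - Q 0%nat j)) = f (p k) - f 0).
  { induction k as [|k IH]; intros Hk; [rewrite E0; simpl; ring|].
    rewrite seq_S, lsum_app. cbn [lsum fold_right Nat.add]. rewrite IH by lia.
    destruct (Hlift (p k)) as [n1 Hn1]; [apply Hp; lia|].
    destruct (Hlift (p (S k))) as [n2 Hn2]; [apply Hp; lia|].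
    rewrite (centered_eq _ (f (p (S k)) - f (p k)) (n1 - n2)).
    - ring.
    - unfold Q. rewrite E0, minus_IZR. lra.
    - apply (HG 0 (p k) 0 (p (S k))); auto; try lra; try (apply Hp; lia).
      rewrite Rminus_diag, Rabs_R0. lra. }
  specialize (Htel N (le_n _)). specialize (Hrows N (le_n _)). unfold row in Hrows, HrowN.
  rewrite EN in Htel. lra.
Qed.

End Winding.

Lemma loop_not_contractible {X} (d : X -> X -> R) (q : X -> R) (f : R -> R) (g : R -> X) :
  circle_cont d q -> continuity f ->
  (forall s, 0 <= s <= 1 -> exists n, f s - q (g s) = IZR n) -> f 0 <> f 1 ->
  ~ contractible_loop X d g.
Proof.
  intros Hq Hf Hl Hne (H & HH & H0 & H1 & Hper). apply Hne.
  apply (winding_zero d q H f); auto.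
  intros s Hs. rewrite H0; auto.
Qed.

(** * Metric graphs *)

Section MetricGraph.
Context {X : Type}.
Variable d : X -> X -> R.
Hypothesis Hd : is_metric X d.

Definition lipschitz (c : R) (g : R -> X) (a b : R) : Prop :=
  forall s t, a <= s <= b -> a <= t <= b -> d (g s) (g t) <= c * Rabs (s - t).

(** The retraction of R to [[a,b]]; composing with it makes maps given on an interval continuous on
    all of R, ready for the extremum and intermediate value theorems. *)
Definition clamp (a b s : R) : R := Rmax a (Rmin b s).

Lemma clamp_in a b s : a <= b -> a <= clamp a b s <= b.
Proof. unfold clamp, Rmax, Rmin. repeat destruct Rle_dec; lra. Qed.

Lemma clamp_id a b s : a <= s <= b -> clamp a b s = s.
Proof. unfold clamp, Rmax, Rmin. repeat destruct Rle_dec; lra. Qed.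

Lemma clamp_below a b s : a <= b -> s <= a -> clamp a b s = a.
Proof. unfold clamp, Rmax, Rmin. repeat destruct Rle_dec; lra. Qed.

Lemma clamp_above a b s : a <= b -> b <= s -> clamp a b s = b.
Proof. unfold clamp, Rmax, Rmin. repeat destruct Rle_dec; lra. Qed.

Lemma clamp_lipschitz a b s t : Rabs (clamp a b s - clamp a b t) <= Rabs (s - t).
Proof.
  unfold clamp, Rmax, Rmin, Rabs. repeat destruct Rle_dec; repeat destruct Rcase_abs; lra.
Qed.

Lemma continuity_eps (f : R -> R) :
  (forall s eps, 0 < eps -> exists del, 0 < del /\ forall t, Rabs (t - s) < del ->
     Rabs (f t - f s) < eps) -> continuity f.
Proof.
  intros H s eps Heps. destruct (H s eps Heps) as (del & Hdel & HD).
  exists del. split; auto. intros t [_ Ht]. apply HD; auto.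
Qed.

Lemma continuity_clamp a b : continuity (clamp a b).
Proof.
  apply continuity_eps. intros s eps Heps. exists eps; split; auto.
  intros t Ht. eapply Rle_lt_trans; [apply clamp_lipschitz|auto].
Qed.

Lemma metric_diff x y w : Rabs (d x w - d y w) <= d x y.
Proof.
  pose proof (metric_tri d Hd x y w). pose proof (metric_tri d Hd y x w) as T.
  rewrite (metric_sym d Hd y x) in T. apply Rabs_le. lra.
Qed.

Lemma metric_pos x y : x <> y -> 0 < d x y.
Proof.
  intros H. destruct (Rle_lt_or_eq_dec 0 (d x y)) as [|E]; auto.
  - apply metric_ge0; auto.
  - exfalso. apply H. apply Hd; auto.
Qed.

(** The distance to [w] attains its minimum along the path, and that minimum is positive. *)
Lemma path_avoids g a b w : lipschitz 1 g a b ->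
  (forall s, a <= s <= b -> g s <> w) ->
  exists del, 0 < del /\ forall s, a <= s <= b -> del <= d (g s) w.
Proof.
  intros Hg Hw. destruct (Rle_lt_dec a b) as [Hab|Hab].
  - destruct (continuity_ab_min (fun s => d (g (clamp a b s)) w) a b Hab) as (m & Hm & Hm').
    + intros c _. apply continuity_eps. intros s eps Heps. exists eps; split; auto.
      intros t Ht. eapply Rle_lt_trans; [apply metric_diff|].
      eapply Rle_lt_trans; [apply Hg; apply clamp_in; auto|].
      rewrite Rmult_1_l. eapply Rle_lt_trans; [apply clamp_lipschitz|auto].
    + exists (d (g m) w). split; [apply metric_pos; auto|].
      intros s Hs. specialize (Hm s Hs). rewrite !clamp_id in Hm; auto.
  - exists 1. split; [lra|]. intros; lra.
Qed.

Variables (V : list X) (n : nat) (L : nat -> R) (phi : nat -> R -> X).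
Hypothesis Hedge : forall i, (i < n)%nat ->
  0 < L i /\ cont_on X d (phi i) 0 (L i) /\
  In (phi i 0) V /\ In (phi i (L i)) V /\
  (forall a b, 0 <= a <= b -> b <= L i -> path_length X d (phi i) a b = Finite (b - a)) /\
  (forall s t, 0 < s < L i -> 0 < t < L i -> phi i s = phi i t -> s = t) /\
  (forall s, 0 < s < L i -> ~ In (phi i s) V).
Hypothesis Hdisj : forall i j s t, (i < n)%nat -> (j < n)%nat -> i <> j ->
  0 < s < L i -> 0 < t < L j -> phi i s <> phi j t.
Hypothesis Hcover : forall x, In x V \/ exists i s, (i < n)%nat /\ 0 <= s <= L i /\ phi i s = x.

(** The partition with one step already bounds the distance of two points by the length between
    them. *)
Lemma edge_lipschitz i : (i < n)%nat -> lipschitz 1 (phi i) 0 (L i).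
Proof.
  intros Hi. destruct (Hedge i Hi) as (_ & _ & _ & _ & Hl & _).
  assert (H : forall a b, 0 <= a <= b -> b <= L i -> d (phi i a) (phi i b) <= b - a).
  { intros a b Ha Hb. specialize (Hl a b Ha Hb). unfold path_length in Hl.
    destruct (Lub_Rbar_correct (fun v => exists l, Defs.partition a b l /\ v = chain_sum X d (phi i) a l))
      as [Hub _]. rewrite Hl in Hub. apply (Hub (d (phi i a) (phi i b))).
    exists [b]. split; [split; simpl; auto; lra|]. simpl. ring. }
  intros s t Hs Ht. rewrite Rmult_1_l. destruct (Rle_dec s t) as [Hst|Hst].
  - rewrite Rabs_minus_sym, Rabs_pos_eq by lra. apply H; lra.
  - rewrite Rabs_pos_eq by lra. rewrite (metric_sym d Hd). apply H; lra.
Qed.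

Lemma lipschitz_sub c g a b a' b' : a <= a' -> b' <= b -> lipschitz c g a b -> lipschitz c g a' b'.
Proof. intros Ha Hb H s t Hs Ht. apply H; lra. Qed.

(** * Interior points of an edge and the collapse onto a circle *)

Section Edge.
Variable i : nat.
Hypothesis Hi : (i < n)%nat.

Lemma edge_inj s t : 0 < s < L i -> 0 < t < L i -> phi i s = phi i t -> s = t.
Proof. apply Hedge; auto. Qed.

(** By compactness an interior point has positive distance from the vertices, the other edges and
    the remote part of its own edge. So open edges are open, and the inverse of their
    parameterization is continuous. *)
Lemma edge_nbhd s0 eps : 0 < s0 < L i -> 0 < eps ->
  exists del, 0 < del /\ forall x, d x (phi i s0) < del ->
    exists s, 0 < s < L i /\ Rabs (s - s0) < eps /\ x = phi i s.
Proof.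
  intros Hs0 Heps. set (w := phi i s0).
  assert (HwV : ~ In w V) by (apply Hedge; auto).
  assert (Hne : forall j s, (j < n)%nat -> 0 <= s <= L j -> (j = i -> s <> s0) -> phi j s <> w).
  { intros j s Hj Hs Hji E. destruct (Hedge j Hj) as (_ & _ & HV0 & HV1 & _).
    destruct (Req_dec s 0) as [->|]; [rewrite E in HV0; auto|].
    destruct (Req_dec s (L j)) as [->|]; [rewrite E in HV1; auto|].
    destruct (Nat.eq_dec j i) as [->|Hne].
    - apply Hji; auto. apply edge_inj; auto; lra.
    - apply (Hdisj j i s s0) in E; auto; lra. }
  destruct (fin_eps V (fun x e => e <= d x w)) as (e1 & He1 & H1).
  { intros; lra. }
  { intros x Hx. exists (d x w). split; [|lra]. apply metric_pos. intros ->; auto. }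
  destruct (fin_eps (seq 0 n) (fun j e => forall s, 0 <= s <= L j ->
    (j = i -> eps <= Rabs (s - s0)) -> e <= d (phi j s) w)) as (e2 & He2 & H2).
  { intros j e e' H He s Hs Hji. specialize (H s Hs Hji). lra. }
  { intros j Hj. apply in_seq in Hj. assert (Hjn : (j < n)%nat) by lia.
    pose proof (edge_lipschitz j Hjn) as Hlip.
    destruct (Nat.eq_dec j i) as [->|Hji].
    - destruct (path_avoids (phi i) 0 (s0 - eps) w) as (e & He & H).
      + apply lipschitz_sub with 0 (L i); auto; lra.
      + intros s Hs. apply Hne; auto; lra.
      + destruct (path_avoids (phi i) (s0 + eps) (L i) w) as (e' & He' & H').
        * apply lipschitz_sub with 0 (L i); auto; lra.
        * intros s Hs. apply Hne; auto; lra.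
        * exists (Rmin e e'). split; [apply Rmin_pos; auto|]. intros s Hs Hse.
          specialize (Hse eq_refl). pose proof (Rmin_l e e'). pose proof (Rmin_r e e').
          unfold Rabs in Hse. destruct Rcase_abs.
          -- specialize (H s ltac:(lra)). lra.
          -- specialize (H' s ltac:(lra)). lra.
    - destruct (path_avoids (phi j) 0 (L j) w) as (e & He & H); [auto| |].
      + intros s Hs. apply Hne; auto; easy.
      + exists e. split; auto. }
  exists (Rmin e1 e2). split; [apply Rmin_pos; auto|]. intros x Hx.
  pose proof (Rmin_l e1 e2). pose proof (Rmin_r e1 e2).
  assert (HxV : ~ In x V) by (intros HV; specialize (H1 x HV); lra).
  destruct (Hcover x) as [HV|(j & s & Hj & Hs & E)]; [easy|].
  assert (Hjs : j = i /\ Rabs (s - s0) < eps).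
  { apply NNPP. intros Hno. specialize (H2 j ltac:(apply in_seq; lia) s Hs).
    rewrite E in H2. assert (e2 <= d x w); [|lra]. apply H2. intros Hji.
    apply Rnot_lt_le. intros Hl. auto. }
  destruct Hjs as [-> Hse]. exists s. split; [|split]; auto.
  destruct (Hedge i Hi) as (_ & _ & HV0 & HV1 & _).
  assert (s <> 0) by (intros ->; apply HxV; rewrite <- E; auto).
  assert (s <> L i) by (intros ->; apply HxV; rewrite <- E; auto).
  lra.
Qed.

Section Arc.
Variables s1 e : R.
Hypothesis He : 0 < e.
Hypothesis Hs1 : e < s1.
Hypothesis Hs1' : s1 + e < L i.

Definition on_arc (x : X) (s : R) : Prop := Rabs (s - s1) <= e /\ x = phi i s.

Definition arc_coord (s : R) : R := (s - s1 + e) / (2 * e).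

(* Collapses the complement of an arc of the edge to a point of R/Z. *)
Definition arc_map (x : X) : R :=
  match excluded_middle_informative (exists s, on_arc x s) with
  | left Hx => arc_coord (proj1_sig (constructive_indefinite_description _ Hx))
  | right _ => 0
  end.

Lemma arc_interior s : Rabs (s - s1) <= e -> 0 < s < L i.
Proof. intros H. apply Rabs_le_between in H. lra. Qed.

Lemma arc_map_on x s : on_arc x s -> arc_map x = arc_coord s.
Proof.
  intros Hx. unfold arc_map. destruct excluded_middle_informative as [Hx'|Hn].
  - destruct constructive_indefinite_description as [s' [Hs' Ex]]. simpl. f_equal.
    destruct Hx as [Hs E]. apply edge_inj; try apply arc_interior; auto. congruence.
  - exfalso. apply Hn. eauto.
Qed.

Lemma arc_map_off x : (forall s, ~ on_arc x s) -> arc_map x = 0.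
Proof.
  intros Hx. unfold arc_map. destruct excluded_middle_informative as [[s Hs]|]; auto.
  destruct (Hx s Hs).
Qed.

Lemma arc_map_circle_cont : circle_cont d arc_map.
Proof.
  intros x eps Heps. destruct (classic (exists s, on_arc x s)) as [[s [Hs Ex]]|Hn].
  - assert (Hpos : 0 < eps * (2 * e)) by nra.
    destruct (edge_nbhd s (eps * (2 * e)) (arc_interior s Hs) Hpos) as (del & Hdel & H).
    rewrite Ex. exists del; split; auto. intros y Hy.
    destruct (H y Hy) as (s' & Hs' & Hss & Ey). rewrite (arc_map_on (phi i s) s) by (split; auto).
    pose proof (Rabs_def2 _ _ Hss) as Hss'. apply Rabs_le_between in Hs.
    assert (Hdiv : forall a, - (eps * (2 * e)) < a < eps * (2 * e) -> Rabs (a / (2 * e)) < eps).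
    { intros a Ha. apply Rabs_def1; [apply Rlt_div_l|apply Rlt_div_r]; lra. }
    destruct (Rle_dec (Rabs (s' - s1)) e) as [Hin|Hout].
    + exists 0%Z. rewrite (arc_map_on y s') by (split; auto).
      replace (arc_coord s' - arc_coord s - 0) with ((s' - s) / (2 * e))
        by (unfold arc_coord; field; lra).
      apply Hdiv; lra.
    + rewrite (arc_map_off y).
      2: { intros s'' [Hs'' Ey']. apply Hout.
           assert (s'' = s') as <-; auto. apply edge_inj; auto; [|congruence].
           apply arc_interior; auto. }
      (* [y] is beyond an end of the arc, so the coordinate of [x] is near 0 or near 1; both are
         near the value 0 of [y] modulo Z. *)
      unfold Rabs in Hout. destruct Rcase_abs.
      * exists 0%Z. replace (0 - arc_coord s - 0) with (- (s - s1 + e) / (2 * e))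
          by (unfold arc_coord; field; lra). apply Hdiv; lra.
      * exists (-1)%Z. replace (0 - arc_coord s - -1) with ((s1 + e - s) / (2 * e))
          by (unfold arc_coord; field; lra). apply Hdiv; lra.
  - destruct (path_avoids (phi i) (s1 - e) (s1 + e) x) as (del & Hdel & H).
    + apply lipschitz_sub with 0 (L i); [lra|lra|]. apply edge_lipschitz; auto.
    + intros s Hs E. apply Hn. exists s. split; auto. apply Rabs_le_between. lra.
    + exists del; split; auto. intros y Hy. exists 0%Z.
      rewrite (arc_map_off x) by (intros s Hs; apply Hn; eauto).
      rewrite (arc_map_off y).
      * rewrite !Rminus_0_r, Rabs_R0; auto.
      * intros s [Hs Ey]. apply Rabs_le_between in Hs. specialize (H s ltac:(lra)).
        rewrite <- Ey in H. lra.
Qed.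

End Arc.
End Edge.

(** * Lipschitz loops and upper bounds for the shortest loop *)

Lemma last_cons {A} (l : list A) x y : last (x :: l) y = last l x.
Proof.
  revert x y. induction l as [|z l IH]; intros x y; [reflexivity|].
  change (last (z :: l) y = last (z :: l) x). rewrite !IH. reflexivity.
Qed.

Lemma chain_sum_lipschitz c g b l a : 0 <= c -> incr_from a l -> last l a <= b -> 0 <= a ->
  lipschitz c g 0 b -> chain_sum X d g a l <= c * (last l a - a) /\ a <= last l a.
Proof.
  intros Hc. revert a. induction l as [|t l IH]; intros a Hl Hb Ha Hg; [simpl; lra|].
  destruct Hl as [Hat Hl].
  rewrite last_cons in *. destruct (IH t Hl Hb ltac:(lra) Hg) as [H1 H2].
  split; [|lra]. simpl. specialize (Hg a t ltac:(lra) ltac:(lra)).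
  rewrite Rabs_minus_sym, Rabs_pos_eq in Hg by lra. lra.
Qed.

Lemma path_length_lipschitz c g : 0 <= c -> lipschitz c g 0 1 ->
  exists v, path_length X d g 0 1 = Finite v /\ v <= c.
Proof.
  intros Hc Hg. unfold path_length.
  destruct (Lub_Rbar_correct (fun v => exists l, Defs.partition 0 1 l /\ v = chain_sum X d g 0 l))
    as [H1 H2].
  specialize (H2 (Finite c)).
  assert (Hub : Rbar_le (Lub_Rbar (fun v => exists l, Defs.partition 0 1 l /\ v = chain_sum X d g 0 l))
    (Finite c)).
  { apply H2. intros v (l & [Hl1 Hl2] & ->). simpl.
    destruct (chain_sum_lipschitz c g 1 l 0 Hc Hl1) as [H _]; auto; [rewrite Hl2; lra|lra|].
    rewrite Hl2 in H. lra. }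
  (* The chain sum of [[1]] bounds the supremum below, so the latter is not minus infinity. *)
  specialize (H1 (d (g 0) (g 1) + 0)).
  assert (Hlb : Rbar_le (Finite (d (g 0) (g 1) + 0))
    (Lub_Rbar (fun v => exists l, Defs.partition 0 1 l /\ v = chain_sum X d g 0 l))).
  { apply H1. exists [1]. split; [split; simpl; auto; lra|reflexivity]. }
  destruct (Lub_Rbar _) as [v| |]; simpl in *; try easy. exists v; auto.
Qed.

Lemma ell_le_lipschitz_loop c g : 0 <= c -> lipschitz c g 0 1 -> g 0 = g 1 ->
  ~ contractible_loop X d g -> Rbar_le (ell X d) (Finite c).
Proof.
  intros Hc Hg Hloop Hn. destruct (path_length_lipschitz c g Hc Hg) as (v & Hv & Hvc).
  apply Rbar_le_trans with (Finite v); auto.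
  destruct (Glb_Rbar_correct (fun v => exists g, loop X d g /\ ~ contractible_loop X d g /\
     path_length X d g 0 1 = Finite v)) as [H1 _].
  apply (H1 v). exists g. split; [split|split]; auto.
  intros t Ht eps Heps. exists (eps / (c + 1)). split; [apply Rdiv_lt_0_compat; lra|].
  intros s Hs Hst. eapply Rle_lt_trans; [apply Hg; auto|].
  apply Rlt_div_r in Hst; [|lra]. pose proof (Rabs_pos (s - t)). nra.
Qed.

(** Pigeonhole: [length V + 1] distinct points cannot all be vertices. *)
Lemma exists_nonvertex g a b : a < b ->
  (forall s t, a <= s <= b -> a <= t <= b -> g s = g t -> s = t) ->
  exists t, a <= t <= b /\ ~ In (g t) V.
Proof.
  intros Hab Hinj. apply NNPP. intros Hn.
  set (m := length V).
  set (tau := fun j => a + (b - a) * (INR j / INR (S m))).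
  assert (Hm : 0 < INR (S m)) by (apply lt_0_INR; lia).
  assert (Htau : forall j, (j <= m)%nat -> a <= tau j <= b).
  { intros j Hj. assert (0 <= INR j / INR (S m) <= 1).
    { pose proof (pos_INR j). assert (INR j <= INR (S m)) by (apply le_INR; lia).
      split; [apply Rdiv_le_0_compat; lra|apply Rle_div_l; lra]. }
    unfold tau. split; nra. }
  assert (Hnd : NoDup (map (fun j => g (tau j)) (seq 0 (S m)))).
  { apply NoDup_map_NoDup_ForallPairs; [|apply seq_NoDup].
    intros j k Hj Hk E. apply in_seq in Hj, Hk.
    apply Hinj in E; [|apply Htau; lia|apply Htau; lia].
    unfold tau in E. apply INR_eq.
    assert (INR j / INR (S m) = INR k / INR (S m)) by nra.
    apply Rmult_eq_reg_r with (/ INR (S m)); auto. apply Rinv_neq_0_compat; lra. }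
  apply NoDup_incl_length with (l' := V) in Hnd.
  - rewrite length_map, length_seq in Hnd. fold m in Hnd. lia.
  - intros x Hx. apply in_map_iff in Hx as (j & <- & Hj). apply in_seq in Hj.
    apply NNPP. intros HV. apply Hn. exists (tau j). split; auto. apply Htau; lia.
Qed.

(* Near t0 such a loop crosses the interior of an edge exactly once, so the arc_map of a
   small arc of that edge has winding number 1 or -1 along it. *)
Lemma ell_le_of_loop k a T t0 : 0 < t0 < a -> a <= T -> lipschitz 1 k 0 T -> k 0 = k T ->
  geod_on X d k 0 a -> (forall s, a <= s <= T -> k s <> k t0) ->
  Rbar_le (ell X d) (Finite T).
Proof.
  intros Ht0 HaT Hlip Hloop Hgeod Hav.
  destruct (path_avoids k a T (k t0)) as (d0 & Hd0 & Hfar0); auto.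
  { apply lipschitz_sub with 0 T; auto; lra. }
  assert (Hinj : forall s t, 0 <= s <= a -> 0 <= t <= a -> k s = k t -> s = t).
  { intros s t Hs Ht E. pose proof (Hgeod s t Hs Ht) as H. rewrite E, metric_xx in H; auto.
    symmetry in H. apply Rabs_eq_0 in H. lra. }
  (* [k t0] may be a vertex. It is replaced by a nearby edge point, from which the loop on [[a,T]]
     still keeps distance at least [d0 / 2]. *)
  assert (Ht1 : exists t1, 0 < t1 < a /\ d (k t0) (k t1) <= d0 / 2 /\ ~ In (k t1) V).
  { set (rho := Rmin (d0 / 2) (Rmin (t0 / 2) ((a - t0) / 2))).
    assert (Hrho : 0 < rho) by (repeat apply Rmin_pos; lra).
    assert (Hrho1 : rho <= d0 / 2) by apply Rmin_l.
    assert (Hrho2 : rho <= t0 / 2) by (eapply Rle_trans; [apply Rmin_r|apply Rmin_l]).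
    assert (Hrho3 : rho <= (a - t0) / 2) by (eapply Rle_trans; [apply Rmin_r|apply Rmin_r]).
    destruct (exists_nonvertex k (t0 - rho) (t0 + rho)) as (t1 & Ht1 & HV); [lra| |].
    - intros s t Hs Ht. apply Hinj; lra.
    - exists t1. split; [lra|split; auto]. rewrite Hgeod by lra.
      apply Rabs_le_between. lra. }
  destruct Ht1 as (t1 & Ht1 & Ht01 & HV).
  destruct (Hcover (k t1)) as [|(i & s1 & Hi & Hs1 & E1)]; [easy|].
  assert (Hs1' : 0 < s1 < L i).
  { destruct (Hedge i Hi) as (_ & _ & HV0 & HV1 & _).
    assert (s1 <> 0) by (intros ->; rewrite E1 in HV0; auto).
    assert (s1 <> L i) by (intros ->; rewrite E1 in HV1; auto). lra. }
  destruct (edge_nbhd i Hi s1 1 Hs1' Rlt_0_1) as (d2 & Hd2 & Hnb).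
  set (eta := Rmin (d2 / 2) (Rmin (t1 / 2) ((a - t1) / 2))).
  assert (Heta : 0 < eta) by (repeat apply Rmin_pos; lra).
  assert (Heta1 : eta <= d2 / 2) by apply Rmin_l.
  assert (Heta2 : eta <= t1 / 2) by (eapply Rle_trans; [apply Rmin_r|apply Rmin_l]).
  assert (Heta3 : eta <= (a - t1) / 2) by (eapply Rle_trans; [apply Rmin_r|apply Rmin_r]).
  clearbody eta.
  (* So short an arc is met only at times within [eta] of [t1]: [eta / 2] excludes the other times
     up to [a], [d0 / 4] those after [a]. The remaining terms keep the arc inside the open edge. *)
  set (e := Rmin (Rmin (eta / 2) (d0 / 4)) (Rmin (s1 / 2) ((L i - s1) / 2))).
  assert (He : 0 < e) by (repeat apply Rmin_pos; lra).
  assert (He1 : e <= eta / 2) by (eapply Rle_trans; [apply Rmin_l|apply Rmin_l]).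
  assert (He2 : e <= d0 / 4) by (eapply Rle_trans; [apply Rmin_l|apply Rmin_r]).
  assert (He3 : e <= s1 / 2) by (eapply Rle_trans; [apply Rmin_r|apply Rmin_l]).
  assert (He4 : e <= (L i - s1) / 2) by (eapply Rle_trans; [apply Rmin_r|apply Rmin_r]).
  clearbody e.
  (* Time is frozen outside the window about [t1], so that the edge coordinate [sig] is defined and
     continuous everywhere. *)
  set (c := clamp (t1 - eta) (t1 + eta)).
  assert (Hc : forall s, t1 - eta <= c s <= t1 + eta) by (intros; apply clamp_in; lra).
  assert (Hsig : forall s, exists v, 0 < v < L i /\ k (c s) = phi i v).
  { intros s. specialize (Hc s). destruct (Hnb (k (c s))) as (v & Hv & _ & E).
    - rewrite E1, Hgeod by lra. apply Rabs_lt_between. lra.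
    - exists v; auto. }
  pose (sig := fun s => proj1_sig (constructive_indefinite_description _ (Hsig s))).
  assert (Hs : forall s, 0 < sig s < L i /\ k (c s) = phi i (sig s)).
  { intros s. unfold sig. apply proj2_sig. }
  clearbody sig. clear Hsig.
  assert (Hsigc : continuity sig).
  { apply continuity_eps. intros s eps Heps. destruct (Hs s) as [Hv E].
    destruct (edge_nbhd i Hi (sig s) eps Hv Heps) as (del & Hdel & H).
    exists del; split; auto. intros t Ht. pose proof (Hc s). pose proof (Hc t).
    destruct (H (k (c t))) as (v & Hv' & Hvs & E').
    - rewrite <- E, Hgeod by lra. eapply Rle_lt_trans; [apply clamp_lipschitz|auto].
    - replace (sig t) with v; auto. destruct (Hs t) as [Hvt Et].
      apply (edge_inj i Hi); auto; congruence. }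
  assert (Hsig1 : forall s, c s = t1 -> sig s = s1).
  { intros s Hcs. destruct (Hs s) as [Hv E]. rewrite Hcs, <- E1 in E.
    apply (edge_inj i Hi); auto. }
  assert (Hsiginj : forall s t, sig s = sig t -> c s = c t).
  { intros s t E. destruct (Hs s) as [_ Es], (Hs t) as [_ Et]. pose proof (Hc s). pose proof (Hc t).
    apply Hinj; [lra|lra|congruence]. }
  assert (Hfar : forall s, 0 <= s <= T -> eta <= Rabs (s - t1) -> e < d (k s) (k t1)).
  { intros s Hs0 Hst. destruct (Rle_dec s a) as [Hsa|Hsa].
    - rewrite Hgeod by lra. lra.
    - specialize (Hfar0 s ltac:(lra)). pose proof (metric_tri d Hd (k s) (k t1) (k t0)) as Htri.
      rewrite (metric_sym d Hd (k t1)) in Htri. lra. }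
  assert (Harc : forall x v, on_arc i s1 e x v -> d x (k t1) <= e).
  { intros x v [Hv ->]. rewrite <- E1. pose proof (arc_interior i s1 e ltac:(lra) ltac:(lra) v Hv).
    eapply Rle_trans; [apply (edge_lipschitz i Hi); lra|]. lra. }
  assert (Hcid : forall s, Rabs (s - t1) < eta -> c s = s).
  { intros s Hst. apply clamp_id. apply Rabs_lt_between in Hst. lra. }
  assert (Hend : forall s, Rabs (c s - t1) >= eta -> e < Rabs (sig s - s1)).
  { intros s Hst. apply Rnot_le_lt. intros Hle. destruct (Hs s) as [_ E].
    pose proof (Harc (k (c s)) (sig s) (conj Hle E)). pose proof (Hc s).
    specialize (Hfar (c s) ltac:(lra) ltac:(lra)). lra. }
  (* [val] of [sig] lifts [arc_map] along the loop: off the arc it is 0 or 1, integers representing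
     the collapsed point. *)
  set (val := fun v => clamp 0 1 (arc_coord s1 e v)).
  assert (Hval0 : forall v, v <= s1 - e -> val v = 0).
  { intros v Hv. apply clamp_below; [lra|]. unfold arc_coord. apply Rle_div_l; lra. }
  assert (Hval1 : forall v, s1 + e <= v -> val v = 1).
  { intros v Hv. apply clamp_above; [lra|]. unfold arc_coord. apply Rle_div_r; lra. }
  assert (HT : 0 < T) by lra.
  apply ell_le_lipschitz_loop with (fun s => k (s * T)); [lra| | |].
  - intros s t Hs0 Ht. eapply Rle_trans; [apply Hlip; split; nra|].
    replace (s * T - t * T) with (T * (s - t)) by ring.
    rewrite Rabs_mult, (Rabs_pos_eq T); lra.
  - rewrite Rmult_0_l, Rmult_1_l; auto.
  - apply loop_not_contractible with (arc_map i s1 e) (fun s => val (sig (s * T))).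
    + apply arc_map_circle_cont; auto; lra.
    + unfold val. apply (continuity_comp (fun s => arc_coord s1 e (sig (s * T))) (clamp 0 1));
        [|apply continuity_clamp].
      apply (continuity_comp (fun s => sig (s * T)) (arc_coord s1 e)).
      * apply (continuity_comp (fun s => s * T) sig); auto.
        apply derivable_continuous. reg.
      * apply derivable_continuous. unfold arc_coord. reg.
    + intros tau Htau. set (s := tau * T). assert (Hs0 : 0 <= s <= T) by (unfold s; nra).
      destruct (Hs s) as [Hv E].
      destruct (Rle_dec (Rabs (sig s - s1)) e) as [Hin|Hout].
      * assert (Hcs : c s = s).
        { apply Hcid. apply Rnot_le_lt. intros Hle.
          assert (Rabs (c s - t1) >= eta); [|specialize (Hend s); lra].
          unfold c, clamp, Rmax, Rmin, Rabs in *. repeat destruct Rle_dec;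
            repeat destruct Rcase_abs; lra. }
        rewrite Hcs in E. exists 0%Z.
        rewrite (arc_map_on i Hi s1 e ltac:(lra) ltac:(lra) (k s) (sig s)) by (split; auto).
        unfold val. rewrite clamp_id; [ring|]. apply Rabs_le_between in Hin. unfold arc_coord.
        split; [apply Rle_div_r; lra|apply Rle_div_l; lra].
      * rewrite arc_map_off.
        -- assert (Hv01 : val (sig s) = 0 \/ val (sig s) = 1).
           { unfold Rabs in Hout. destruct Rcase_abs; [left; apply Hval0|right; apply Hval1]; lra. }
           destruct Hv01 as [-> | ->]; [exists 0%Z|exists 1%Z]; lra.
        -- intros v Hon. assert (Hcs : c s = s).
           { apply Hcid. apply Rnot_le_lt. intros Hle. specialize (Hfar s Hs0 Hle).
             pose proof (Harc _ _ Hon). lra. }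
           rewrite Hcs in E. destruct Hon as [Hv' E']. apply Hout.
           replace (sig s) with v; auto.
           apply (edge_inj i Hi); auto; [|congruence].
           apply (arc_interior i s1 e); auto; lra.
    + rewrite Rmult_0_l, Rmult_1_l.
      assert (Hc0 : c 0 = t1 - eta) by (apply clamp_below; lra).
      assert (HcT : c T = t1 + eta) by (apply clamp_above; lra).
      assert (Hct : c t1 = t1) by (apply Hcid; rewrite Rminus_diag, Rabs_R0; auto).
      assert (Hst1 : sig t1 = s1) by auto.
      assert (H0 : e < Rabs (sig 0 - s1)).
      { apply Hend. rewrite Hc0. replace (t1 - eta - t1) with (- eta) by ring.
        rewrite Rabs_Ropp, Rabs_pos_eq; lra. }
      assert (H1 : e < Rabs (sig T - s1)).
      { apply Hend. rewrite HcT. replace (t1 + eta - t1) with eta by ring.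
        rewrite Rabs_pos_eq; lra. }
      (* [sig 0] and [sig T] lie on opposite sides of [s1]; otherwise a value [y] between [s1] and
         both would be taken before and after [t1], against injectivity on the window. *)
      assert (Hside : forall y, y <> s1 -> Rmin (sig 0) s1 <= y <= Rmax (sig 0) s1 ->
        Rmin s1 (sig T) <= y <= Rmax s1 (sig T) -> False).
      { intros y Hy Hy0 HyT. rewrite <- Hst1 in Hy0, HyT.
        destruct (IVT_gen sig 0 t1 y Hsigc Hy0) as (x & Hx & Ex).
        destruct (IVT_gen sig t1 T y Hsigc HyT) as (x' & Hx' & Ex').
        rewrite Rmin_left, Rmax_right in Hx, Hx' by lra.
        assert (Ecx : c x = c x') by (apply Hsiginj; congruence).
        assert (Hcx : c x = t1).
        { clear - Ecx Hx Hx' Heta. unfold c, clamp, Rmax, Rmin in *.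
          repeat destruct Rle_dec; lra. }
        apply Hy. rewrite <- Ex. auto. }
      intros Heq. unfold Rabs in H0, H1. destruct Rcase_abs; destruct Rcase_abs.
      * apply (Hside (s1 - e)); [lra| |].
        -- rewrite Rmin_left, Rmax_right; lra.
        -- rewrite Rmin_right, Rmax_left; lra.
      * rewrite Hval0, Hval1 in Heq; lra.
      * rewrite Hval1, Hval0 in Heq; lra.
      * apply (Hside (s1 + e)); [lra| |].
        -- rewrite Rmin_right, Rmax_left; lra.
        -- rewrite Rmin_left, Rmax_right; lra.
Qed.

(** * Geodesic triangles as loops *)

Definition concat_path (g h : R -> X) (a : R) : R -> X :=
  fun s => if Rle_dec s a then g s else h (s - a).

Lemma concat_path_right g h a s : g a = h 0 -> a <= s -> concat_path g h a s = h (s - a).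
Proof.
  intros E Hs. unfold concat_path. destruct Rle_dec; auto.
  replace s with a by lra. rewrite Rminus_diag; auto.
Qed.

Lemma concat_path_left g h a s : s <= a -> concat_path g h a s = g s.
Proof. intros Hs. unfold concat_path. destruct Rle_dec; easy. Qed.

Lemma lipschitz_concat g h a b : 0 <= a -> 0 <= b -> g a = h 0 ->
  lipschitz 1 g 0 a -> lipschitz 1 h 0 b -> lipschitz 1 (concat_path g h a) 0 (a + b).
Proof.
  intros Ha Hb E Hg Hh.
  assert (H : forall s t, 0 <= s <= a -> 0 <= t <= b -> d (g s) (h t) <= a - s + t).
  { intros s t Hs Ht. pose proof (metric_tri d Hd (g s) (g a) (h t)).
    specialize (Hg s a Hs ltac:(lra)). specialize (Hh 0 t ltac:(lra) Ht). rewrite <- E in Hh.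
    rewrite Rabs_minus_sym, Rabs_pos_eq in Hg by lra.
    rewrite Rabs_minus_sym, Rabs_pos_eq in Hh by lra. lra. }
  intros s t Hs Ht. unfold concat_path. destruct (Rle_dec s a), (Rle_dec t a).
  - apply Hg; lra.
  - specialize (H s (t - a) ltac:(lra) ltac:(lra)).
    rewrite Rabs_minus_sym, Rabs_pos_eq by lra. lra.
  - specialize (H t (s - a) ltac:(lra) ltac:(lra)). rewrite (metric_sym d Hd).
    rewrite Rabs_pos_eq by lra. lra.
  - replace (s - t) with ((s - a) - (t - a)) by ring. apply Hh; lra.
Qed.

Lemma geod_lipschitz g a : geod_on X d g 0 a -> lipschitz 1 g 0 a.
Proof. intros H s t Hs Ht. rewrite H; auto. lra. Qed.

Lemma graph_thin_triangles c : Rbar_le (Finite c) (ell X d) -> thin_triangles d c.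
Proof.
  intros Hell x y z gxy gyz gzx t Hper (Hg1 & E10 & E11) (Hg2 & E20 & E21) (Hg3 & E30 & E31) Ht.
  apply NNPP. intros Hn.
  pose proof (metric_ge0 d Hd x y). pose proof (metric_ge0 d Hd y z).
  pose proof (metric_ge0 d Hd z x).
  (* The ends of a side lie on the adjacent sides, so [t] is interior, as [ell_le_of_loop]
     demands. *)
  assert (Ht0 : t <> 0).
  { intros ->. apply Hn. right. exists (d z x). split; [lra|congruence]. }
  assert (Ht1 : t <> d x y).
  { intros ->. apply Hn. left. exists 0. split; [lra|congruence]. }
  set (k1 := concat_path gxy gyz (d x y)).
  set (k := concat_path k1 gzx (d x y + d y z)).
  assert (Ek1 : k1 (d x y + d y z) = gzx 0).
  { unfold k1. rewrite concat_path_right by (congruence || lra).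
    replace (d x y + d y z - d x y) with (d y z) by ring. congruence. }
  assert (Hk : forall s, s <= d x y -> k s = gxy s).
  { intros s Hs. unfold k, k1. rewrite !concat_path_left by lra. reflexivity. }
  assert (Hle : Rbar_le (ell X d) (Finite (d x y + d y z + d z x))).
  { apply (ell_le_of_loop k (d x y) _ t); try lra.
    - apply lipschitz_concat; auto; try lra.
      + apply lipschitz_concat; auto; try apply geod_lipschitz; auto. congruence.
      + apply geod_lipschitz; auto.
    - rewrite Hk by lra. unfold k. rewrite concat_path_right by (auto; lra).
      replace (d x y + d y z + d z x - (d x y + d y z)) with (d z x) by ring. congruence.
    - intros s s' Hs Hs'. rewrite !Hk by lra. apply Hg1; auto.
    - intros s Hs E. apply Hn. rewrite (Hk t) in E by lra.
      destruct (Rle_dec s (d x y + d y z)) as [Hs2|Hs2].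
      + left. exists (s - d x y). split; [lra|]. rewrite <- E. unfold k.
        rewrite concat_path_left by lra. unfold k1. rewrite concat_path_right; auto; [congruence|lra].
      + right. exists (s - (d x y + d y z)). split; [lra|]. rewrite <- E. unfold k.
        rewrite concat_path_right; auto. lra. }
  pose proof (Rbar_le_trans _ _ _ Hell Hle) as Hc. simpl in Hc. lra.
Qed.

End MetricGraph.

Theorem mainTheorem13 (X : Type) (d : X -> X -> R) (r : R) :
  is_metric X d ->
  ((is_metric_graph X d /\ 0 < r /\ Rbar_le (Finite (4 * r)) (ell X d)) \/
   (geodesic_space X d /\ Rbar_lt (Finite 0) (rX X d) /\ 0 < r /\
    Rbar_le (Finite (2 * r)) (rX X d))) ->
  incl_he X (Cech X d (r / 2)) (Rips X d r) /\ incl_he X (Rips X d r) (Cech X d r).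
Proof.
  intros Hd [[[Hgeo (V & n & L & phi & H1 & H2 & H3)] [Hr Hell]]|[Hgeo (_ & Hr & HrX)]].
  - destruct (combing_of_thin d r Hd Hgeo) as [g Hg].
    + apply (graph_thin_triangles d Hd V n L phi); auto.
    + apply (incl_he_of_combing d r Hd Hr g Hg).
  - destruct (combing_of_rX d r Hd Hr Hgeo HrX) as [g Hg].
    apply (incl_he_of_combing d r Hd Hr g Hg).
Qed.
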